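(* Let $\mathbf H$ be a connected Hopf monoid in vector species that is linearized in the basis $\mathbf h$, and let $\mathbf L\times\mathbf H$ be the Hadamard product of the Hopf monoid of linear orders $\mathbf L$ with $\mathbf H$. Let $I$ be a finite set and $(\alpha,x)\in(\mathbf l\times\mathbf h)[I]$, i.e. $\alpha$ is a linear order on $I$ and $x\in\mathbf h[I]$. Then the antipode $S$ of $\mathbf L\times\mathbf H$ satisfies $$S_I(\alpha,x)=\sum_{(\beta,y)\in(\mathbf l\times\mathbf h)[I]} c_{\alpha,x}^{\beta,y}\,(\beta,y),\qquad c_{\alpha,x}^{\beta,y}=\sum_{A\in\mathcal C_{\alpha,x}^{\beta,y}}(-1)^{\ell(A)},$$ and for every $(\beta,y)$ one has $c_{\alpha,x}^{\beta,y}\in\{1,-1,0\}$.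
   Context: Work over a field $\Bbbk$ of characteristic $0$. A vector species assigns to each finite set $I$ a vector space $\mathbf H[I]$, functorially in bijections. A connected Hopf monoid $\mathbf H$ consists of linear maps $\mu_{A_1,A_2}:\mathbf H[A_1]\otimes\mathbf H[A_2]\to\mathbf H[I]$ and $\Delta_{A_1,A_2}:\mathbf H[I]\to\mathbf H[A_1]\otimes\mathbf H[A_2]$ for every ordered pair of disjoint subsets $(A_1,A_2)$ with $A_1\cup A_2=I$, satisfying associativity, coassociativity, the compatibility axiom between $\mu$ and $\Delta$, $\mathbf H[\emptyset]=\Bbbk$, and the unit/counit identifications. A set composition $A=(A_1,\dots,A_k)\models I$ is a sequence of nonempty pairwise disjoint subsets with union $I$; $\ell(A)=k$. Iterated maps: $\mu_{A}=\mu_{A_1,I\setminus A_1}(\mathrm{id}\otimes\mu_{A_2,\dots,A_k})$, $\Delta_A=(\mathrm{id}\otimes\Delta_{A_2,\dots,A_k})\Delta_{A_1,I\setminus A_1}$ (identity when $k=1$). The antipode is $S_I=\sum_{A\models I}(-1)^{\ell(A)}\mu_A\Delta_A$. $\mathbf H$ is linearized in a basis $\mathbf h$ (a set species with $\mathbf H[I]=\Bbbk\mathbf h[I]$) if each $\mu_{A_1,A_2}$ sends pairs of basis elements to basis elements and each $\Delta_{A_1,A_2}$ sends a basis element either to $0$ or to a tensor $u\otimes v$ of basis elements. $\mathbf L[I]$ has basis $\mathbf l[I]$, the linear orders on $I$, with product concatenation and coproduct $\alpha\mapsto\alpha|_{A_1}\otimes\alpha|_{A_2}$ (restrictions). The Hadamard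 product has $(\mathbf L\times\mathbf H)[I]=\mathbf L[I]\otimes\mathbf H[I]$ with componentwise product and coproduct. For $\alpha\in\mathbf l[I]$ and $A\models I$ put $\alpha_A=\alpha|_{A_1}\cdot\alpha|_{A_2}\cdots\alpha|_{A_k}$ (concatenation); for $x\in\mathbf h[I]$ with $\Delta_A(x)\neq0$ put $x_A=\mu_A\Delta_A(x)\in\mathbf h[I]$. Define $\mathcal C_{\alpha,x}^{\beta,y}=\{A\models I:\Delta_A(x)\ne0,\ \alpha_A=\beta,\ x_A=y\}$. *)

(* Defs.v *)
From HB Require Import structures.
From mathcomp Require Import all_boot all_order all_algebra.
From mathcomp Require Import generic_quotient finmap.
From mathcomp Require Import boolp classical_sets cardinality fsbigop.

Set Implicit Arguments.
Unset Strict Implicit.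
Unset Printing Implicit Defensive.

Import GRing.Theory.
Local Open Scope quotient_scope.
Local Open Scope fset_scope.
Local Open Scope ring_scope.

Section Tensor.
Variables (K : fieldType) (V W : lmodType K).

Definition bilin (X : lmodType K) (f : V -> W -> X) : Prop :=
  (forall w, linear (f^~ w)) /\ (forall v, linear (f v)).

Definition tens_eval (X : lmodType K) (f : V -> W -> X) (s : seq (V * W)) : X :=
  \sum_(p <- s) f p.1 p.2.

(* Formal sums of pure tensors, identified when no bilinear map separates
   them; the universal property is [tlift_tens], [tlift_linear], [tens_sum]. *)
Definition tens_eqv (s t : seq (V * W)) : bool :=
  `[< forall (X : lmodType K) (f : V -> W -> X),
        bilin f -> tens_eval f s = tens_eval f t >].

Lemma tens_eqv_refl : reflexive tens_eqv.
Proof. by move=> s; apply/asboolP. Qed.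

Lemma tens_eqv_sym : symmetric tens_eqv.
Proof.
by move=> s t; apply/asboolP/asboolP => st X f bf; rewrite st.
Qed.

Lemma tens_eqv_trans : transitive tens_eqv.
Proof.
move=> t s u /asboolP st /asboolP tu; apply/asboolP => X f bf.
by rewrite st // tu.
Qed.

Canonical tens_equiv := EquivRel tens_eqv tens_eqv_refl tens_eqv_sym tens_eqv_trans.

Definition tensor := {eq_quot tens_equiv}.
HB.instance Definition _ := Choice.on tensor.
HB.instance Definition _ := Quotient.on tensor.
HB.instance Definition _ := EqQuotient.on tensor.

Implicit Types s t u : seq (V * W).

Lemma tensP s t : reflect
  (forall (X : lmodType K) (f : V -> W -> X),
     bilin f -> tens_eval f s = tens_eval f t)
  (\pi_tensor s == \pi_tensor t).
Proof. by rewrite eqmodE; exact: asboolP. Qed.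

Lemma tens_eval_repr (X : lmodType K) (f : V -> W -> X) s :
  bilin f -> tens_eval f (repr (\pi_tensor s)) = tens_eval f s.
Proof. by move=> bf; apply: (tensP _ _ _) bf; rewrite reprK. Qed.

Lemma tens_eval_cat (X : lmodType K) (f : V -> W -> X) s t :
  tens_eval f (s ++ t) = tens_eval f s + tens_eval f t.
Proof. exact: big_cat. Qed.

Definition seq_scale (k : K) s := [seq (k *: p.1, p.2) | p <- s].

Lemma tens_eval_scale (X : lmodType K) (f : V -> W -> X) k s :
  bilin f -> tens_eval f (seq_scale k s) = k *: tens_eval f s.
Proof.
case=> fl _; rewrite /tens_eval big_map scaler_sumr; apply: eq_bigr => p _ /=.
exact: (scalable_linear (fl p.2)).
Qed.

Definition tens_zero : tensor := \pi_tensor [::].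
Definition tens_add (a b : tensor) : tensor := \pi_tensor (repr a ++ repr b).
Definition tens_scale k (a : tensor) : tensor := \pi_tensor (seq_scale k (repr a)).
Definition tens_opp (a : tensor) : tensor := tens_scale (-1) a.

Definition tlift (X : lmodType K) (f : V -> W -> X) (a : tensor) : X :=
  tens_eval f (repr a).

Lemma tlift_add (X : lmodType K) (f : V -> W -> X) a b :
  bilin f -> tlift f (tens_add a b) = tlift f a + tlift f b.
Proof. by move=> bf; rewrite /tlift tens_eval_repr // tens_eval_cat. Qed.

Lemma tlift_zero (X : lmodType K) (f : V -> W -> X) : bilin f -> tlift f tens_zero = 0.
Proof. by move=> bf; rewrite /tlift tens_eval_repr // /tens_eval big_nil. Qed.

Lemma tlift_scale (X : lmodType K) (f : V -> W -> X) k a :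
  bilin f -> tlift f (tens_scale k a) = k *: tlift f a.
Proof. by move=> bf; rewrite /tlift tens_eval_repr // tens_eval_scale. Qed.

Lemma tens_ext (a b : tensor) :
  (forall (X : lmodType K) (f : V -> W -> X), bilin f -> tlift f a = tlift f b) ->
  a = b.
Proof. by move=> ab; rewrite -[a]reprK -[b]reprK; apply/eqP/tensP. Qed.

Fact tens_addA : associative tens_add.
Proof. by move=> a b c; apply: tens_ext => X f bf; rewrite !tlift_add // addrA. Qed.
Fact tens_addC : commutative tens_add.
Proof. by move=> a b; apply: tens_ext => X f bf; rewrite !tlift_add // addrC. Qed.
Fact tens_add0 : left_id tens_zero tens_add.
Proof.
by move=> a; apply: tens_ext => X f bf; rewrite tlift_add // tlift_zero // add0r.
Qed.
Fact tens_addN : left_inverse tens_zero tens_opp tens_add.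
Proof.
move=> a; apply: tens_ext => X f bf.
by rewrite tlift_add // tlift_zero // tlift_scale // scaleN1r addNr.
Qed.

HB.instance Definition _ :=
  GRing.isZmodule.Build tensor tens_addA tens_addC tens_add0 tens_addN.

Fact tens_scaleA j k a : tens_scale j (tens_scale k a) = tens_scale (j * k) a.
Proof. by apply: tens_ext => X f bf; rewrite !tlift_scale // scalerA. Qed.
Fact tens_scale1 : left_id 1 tens_scale.
Proof. by move=> a; apply: tens_ext => X f bf; rewrite !tlift_scale // scale1r. Qed.
Fact tens_scaleDr : right_distributive tens_scale +%R.
Proof.
move=> k a b; apply: tens_ext => X f bf.
by rewrite tlift_scale // !tlift_add // !tlift_scale // scalerDr.
Qed.
Fact tens_scaleDl a : {morph tens_scale^~ a : j k / j + k}.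
Proof.
move=> j k; apply: tens_ext => X f bf.
by rewrite tlift_scale // tlift_add // !tlift_scale // scalerDl.
Qed.

HB.instance Definition _ := GRing.Zmodule_isLmodule.Build K tensor
  tens_scaleA tens_scale1 tens_scaleDr tens_scaleDl.

Definition tens (v : V) (w : W) : tensor := \pi_tensor [:: (v, w)].

Lemma tlift_linear (X : lmodType K) (f : V -> W -> X) : bilin f -> linear (tlift f).
Proof. by move=> bf k a b; rewrite tlift_add // tlift_scale. Qed.

Lemma tlift_tens (X : lmodType K) (f : V -> W -> X) v w : bilin f -> tlift f (tens v w) = f v w.
Proof.
by move=> bf; rewrite /tlift tens_eval_repr // /tens_eval big_seq1.
Qed.

Lemma tens_bilin : bilin tens.
Proof.
split=> [w|v] k a b; apply: tens_ext => X f bf.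
  by rewrite tlift_linear // !tlift_tens //; case: bf => [-> _].
by rewrite tlift_linear // !tlift_tens //; case: bf => [_ ->].
Qed.

Lemma tens_sum (a : tensor) : a = \sum_(p <- repr a) tens p.1 p.2.
Proof.
apply: tens_ext => X f bf.
rewrite [RHS](big_morph (tlift f) (id1 := 0) (op1 := +%R)).
- by apply: eq_bigr => p _; rewrite tlift_tens.
- by move=> b c; exact: tlift_add.
- exact: tlift_zero.
Qed.

End Tensor.

Notation "v *t w" := (tens v w) (at level 40, left associativity) : ring_scope.

Lemma bilin_ext (K : fieldType) (V W X : lmodType K) (f g : {linear tensor V W -> X}) :
  (forall v w, f (v *t w) = g (v *t w)) -> f =1 g.
Proof.
by move=> fg a; rewrite [a]tens_sum !linear_sum; apply: eq_bigr => p _; apply: fg.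
Qed.

Section TensorMaps.
Variable K : fieldType.

Lemma tensDl (V W : lmodType K) (v v' : V) (w : W) : (v + v') *t w = v *t w + v' *t w.
Proof. by have := (tens_bilin V W).1 w 1 v v'; rewrite !scale1r. Qed.
Lemma tensDr (V W : lmodType K) (v : V) (w w' : W) : v *t (w + w') = v *t w + v *t w'.
Proof. by have := (tens_bilin V W).2 v 1 w w'; rewrite !scale1r. Qed.
Lemma tensZl (V W : lmodType K) k (v : V) (w : W) : (k *: v) *t w = k *: (v *t w).
Proof. exact: (scalable_linear ((tens_bilin V W).1 w)). Qed.
Lemma tensZr (V W : lmodType K) k (v : V) (w : W) : v *t (k *: w) = k *: (v *t w).
Proof. exact: (scalable_linear ((tens_bilin V W).2 v)). Qed.

Section Map.
Variables (V W V' W' : lmodType K) (f : {linear V -> V'}) (g : {linear W -> W'}).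
Definition tmap : tensor V W -> tensor V' W' := tlift (fun v w => f v *t g w).
Fact tmap_bilin : bilin (fun v w => f v *t g w).
Proof.
by split=> [w|v] k a b; rewrite linearP ?tensDl ?tensDr ?tensZl ?tensZr.
Qed.
HB.instance Definition _ :=
  GRing.isLinear.Build K _ _ _ tmap (tlift_linear tmap_bilin).
Lemma tmapE v w : tmap (v *t w) = f v *t g w.
Proof. exact: (tlift_tens _ _ tmap_bilin). Qed.
End Map.

Section Assoc.
Variables V W X : lmodType K.
Definition tassoc_in (a : tensor V W) (x : X) : tensor V (tensor W X) :=
  tlift (fun v w => v *t (w *t x)) a.
Fact tassoc_in_bilin0 x : bilin (fun (v : V) (w : W) => v *t (w *t x) : tensor V (tensor W X)).
Proof. by split=> [w|v] k a b; rewrite ?tensDl ?tensDr ?tensZl ?tensZr ?tensDr ?tensZr. Qed.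
Fact tassoc_in_bilin : bilin tassoc_in.
Proof.
split=> [x|a]; first exact: (tlift_linear (tassoc_in_bilin0 x)).
move=> k x y; rewrite /tassoc_in /tlift /tens_eval scaler_sumr -big_split /=.
by apply: eq_bigr => p _; rewrite tensDr tensZr tensDr tensZr.
Qed.
(* (v *t w) *t x |-> v *t (w *t x) *)
Definition tassoc : tensor (tensor V W) X -> tensor V (tensor W X) := tlift tassoc_in.
HB.instance Definition _ :=
  GRing.isLinear.Build K _ _ _ tassoc (tlift_linear tassoc_in_bilin).
Lemma tassocE v w x : tassoc ((v *t w) *t x) = v *t (w *t x).
Proof.
rewrite /tassoc (tlift_tens _ _ tassoc_in_bilin).
exact: (tlift_tens _ _ (tassoc_in_bilin0 x)).
Qed.
End Assoc.

Section Interchange.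
Variables V W X Y : lmodType K.
Definition tswap_in2 (v : V) (w : W) (b : tensor X Y) :
    tensor (tensor V X) (tensor W Y) :=
  tlift (fun x y => (v *t x) *t (w *t y)) b.
Definition tswap_in (a : tensor V W) (b : tensor X Y) :
    tensor (tensor V X) (tensor W Y) :=
  tlift (fun v w => tswap_in2 v w b) a.
(* (v *t w) *t (x *t y) |-> (v *t x) *t (w *t y) *)
Definition tswap : tensor (tensor V W) (tensor X Y) -> tensor (tensor V X) (tensor W Y) :=
  tlift tswap_in.

Fact tswap_in2_bilin0 v w : bilin (fun (x : X) (y : Y) => (v *t x) *t (w *t y) :
   tensor (tensor V X) (tensor W Y)).
Proof.
by split=> [y|x] k a b; rewrite !(tensDr, tensZr) ?(tensDl, tensZl).
Qed.
Fact tswap_in2_bilin b : bilin (fun v w => tswap_in2 v w b).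
Proof.
split=> [w|v] k a c; rewrite /tswap_in2 /tlift /tens_eval scaler_sumr -big_split /=.
  by apply: eq_bigr => p _; rewrite !(tensDl, tensZl).
by apply: eq_bigr => p _; rewrite tensDl tensZl tensDr tensZr.
Qed.
Fact tswap_in_bilin : bilin tswap_in.
Proof.
split=> [b|a]; first exact: (tlift_linear (tswap_in2_bilin b)).
move=> k b c; rewrite /tswap_in {1 2 3}/tlift /tens_eval scaler_sumr -big_split /=.
by apply: eq_bigr => p _; exact: (tlift_linear (tswap_in2_bilin0 p.1 p.2)).
Qed.
HB.instance Definition _ :=
  GRing.isLinear.Build K _ _ _ tswap (tlift_linear tswap_in_bilin).
Lemma tswapE v w x y : tswap ((v *t w) *t (x *t y)) = (v *t x) *t (w *t y).
Proof.
rewrite /tswap (tlift_tens _ _ tswap_in_bilin).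
rewrite /tswap_in (tlift_tens _ _ (tswap_in2_bilin _)).
exact: (tlift_tens _ _ (tswap_in2_bilin0 v w)).
Qed.
End Interchange.

End TensorMaps.

Section Decompositions.
Variable U : choiceType.
Implicit Types A B I : {fset U}.

Definition decomp A B I : bool := (A `&` B == fset0) && (A `|` B == I).

Definition setcomp I (A : seq {fset U}) : bool :=
  [&& fset0 \notin A, pairwise (fun B C => [disjoint B & C]) A
    & \bigcup_(B <- A) B == I].

Lemma finite_setcomp I : finite_set [set A | setcomp I A]%classic.
Proof.
pose r := flatten [seq permutations (enum_fset P) | P <- enum_fset (fpowerset (fpowerset I))].
apply: (sub_finite_set _ (finite_seq r)) => A /= /and3P[nA dA /eqP UA].
have uA : uniq A.
  rewrite uniq_pairwise; apply: (sub_in_pairwise (P := mem A)) (allss A) dA.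
  move=> B C BA _ dBC; apply/eqP => eBC.
  move: dBC; rewrite /fdisjoint -eBC fsetIid => /eqP B0.
  by move: nA; rewrite -B0 BA.
have PA : [fset B in A] \in fpowerset (fpowerset I).
  rewrite fpowersetE; apply/fsubsetP => B; rewrite !inE /= => BA.
  rewrite fpowersetE -UA; apply/fsubsetP => i iB; apply/bigfcupP.
  by exists B; rewrite ?BA.
apply/flattenP; exists (permutations (enum_fset [fset B in A])).
  exact: (map_f (fun P : {fset {fset U}} => permutations (enum_fset P)) PA).
rewrite mem_permutations; apply: uniq_perm => //; first exact: fset_uniq.
by move=> B; rewrite inE.
Qed.

End Decompositions.

Definition restricts (U V : choiceType) (A I : {fset U}) (A' I' : {fset V})
    (f : I -> I') (g : A -> A') : Prop :=
  forall (i : I) (a : A), val i = val a -> val (f i) = val (g a).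

(* A finite set is a finite subset of some type [U].  The maps are total for
   convenience: [hmap f] is meaningful only for bijective [f], and
   [hmul A B I], [hcomul A B I] only when [decomp A B I]. *)
Record hopf_data (K : fieldType) := HopfData {
  hobj : forall U : choiceType, {fset U} -> lmodType K;
  hmap : forall (U V : choiceType) (I : {fset U}) (J : {fset V}),
    (I -> J) -> {linear hobj I -> hobj J};
  hunit : forall U : choiceType, {linear K^o -> hobj (fset0 : {fset U})};
  hmul : forall (U : choiceType) (A B I : {fset U}),
    {linear tensor (hobj A) (hobj B) -> hobj I};
  hcomul : forall (U : choiceType) (A B I : {fset U}),
    {linear hobj I -> tensor (hobj A) (hobj B)}
}.

Arguments hobj {K} h {U} I.
Arguments hmap {K} h {U V I J} f.
Arguments hunit {K} h U.
Arguments hmul {K} h {U} A B I.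
Arguments hcomul {K} h {U} A B I.

Record connected_hopf_monoid (K : fieldType) (H : hopf_data K) : Prop := {
  hmap_id : forall (U : choiceType) (I : {fset U}), hmap H (@id I) =1 id;
  hmap_comp : forall (U V W : choiceType) (I : {fset U}) (J : {fset V})
      (L : {fset W}) (f : I -> J) (g : J -> L),
    bijective f -> bijective g -> hmap H (g \o f) =1 hmap H g \o hmap H f;
  hunit_bij : forall U : choiceType, bijective (hunit H U);
  hunit_nat : forall (U V : choiceType)
      (f : (fset0 : {fset U}) -> (fset0 : {fset V})),
    hmap H f \o hunit H U =1 hunit H V;
  hmul_nat : forall (U V : choiceType) (A B I : {fset U}) (A' B' I' : {fset V})
      (f : I -> I') (g : A -> A') (k : B -> B'),
    decomp A B I -> decomp A' B' I' ->
    bijective f -> bijective g -> bijective k -> restricts f g -> restricts f k ->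
    hmap H f \o hmul H A B I =1 hmul H A' B' I' \o tmap (hmap H g) (hmap H k);
  hcomul_nat : forall (U V : choiceType) (A B I : {fset U}) (A' B' I' : {fset V})
      (f : I -> I') (g : A -> A') (k : B -> B'),
    decomp A B I -> decomp A' B' I' ->
    bijective f -> bijective g -> bijective k -> restricts f g -> restricts f k ->
    hcomul H A' B' I' \o hmap H f =1 tmap (hmap H g) (hmap H k) \o hcomul H A B I;
  hmul_unitl : forall (U : choiceType) (I : {fset U}) (x : hobj H I),
    hmul H fset0 I I (hunit H U 1 *t x) = x;
  hmul_unitr : forall (U : choiceType) (I : {fset U}) (x : hobj H I),
    hmul H I fset0 I (x *t hunit H U 1) = x;
  hcomul_counitl : forall (U : choiceType) (I : {fset U}) (x : hobj H I),
    hcomul H fset0 I I x = hunit H U 1 *t x;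
  hcomul_counitr : forall (U : choiceType) (I : {fset U}) (x : hobj H I),
    hcomul H I fset0 I x = x *t hunit H U 1;
  hmulA : forall (U : choiceType) (A B C AB BC I : {fset U}),
    decomp A B AB -> decomp B C BC -> decomp AB C I -> decomp A BC I ->
    hmul H AB C I \o tmap (hmul H A B AB) idfun =1
    hmul H A BC I \o tmap idfun (hmul H B C BC) \o @tassoc _ _ _ _;
  hcomulA : forall (U : choiceType) (A B C AB BC I : {fset U}),
    decomp A B AB -> decomp B C BC -> decomp AB C I -> decomp A BC I ->
    @tassoc _ _ _ _ \o tmap (hcomul H A B AB) idfun \o hcomul H AB C I =1
    tmap idfun (hcomul H B C BC) \o hcomul H A BC I;
  hcompat : forall (U : choiceType) (A B C D I : {fset U}),
    decomp A B I -> decomp C D I ->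
    hcomul H C D I \o hmul H A B I =1
    tmap (hmul H (A `&` C) (B `&` C) C) (hmul H (A `&` D) (B `&` D) D)
    \o @tswap _ _ _ _ _
    \o tmap (hcomul H (A `&` C) (A `&` D) A) (hcomul H (B `&` C) (B `&` D) B)
}.

Section Antipode.
Variables (K : fieldType) (H : hopf_data K) (U : choiceType).
Implicit Types (A I J : {fset U}) (As : seq {fset U}).

(* The identity of H[I] when I = J, and 0 otherwise. *)
Definition hcast I J : {linear hobj H I -> hobj H J} :=
  match I =P J with
  | ReflectT e => ecast X {linear hobj H I -> hobj H X} e idfun
  | ReflectF _ => \0
  end.

Lemma hcast_id I : hcast I I =1 id.
Proof.
by move=> x; rewrite /hcast; case: eqP => // e; rewrite (eq_irrelevance e erefl).
Qed.

Fixpoint tensors1 A As : lmodType K :=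
  if As is B :: Bs then tensor (hobj H A) (tensors1 B Bs) else hobj H A.

Fixpoint hmuls1 A As I : {linear tensors1 A As -> hobj H I} :=
  match As return {linear tensors1 A As -> hobj H I} with
  | [::] => hcast A I
  | B :: Bs =>
    hmul H A (I `\` A) I \o tmap idfun (hmuls1 B Bs (I `\` A))
  end.

Fixpoint hcomuls1 A As I : {linear hobj H I -> tensors1 A As} :=
  match As return {linear hobj H I -> tensors1 A As} with
  | [::] => hcast I A
  | B :: Bs =>
    tmap idfun (hcomuls1 B Bs (I `\` A)) \o hcomul H A (I `\` A) I
  end.

(* H[A_1] (x) ... (x) H[A_k]; the empty product, i.e. the base field, is
   taken to be H[0], so that both iterated maps of the empty composition of
   the empty set are the identity. *)
Definition tensors As : lmodType K :=
  if As is A :: As' then tensors1 A As' else hobj H (fset0 : {fset U}).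

Definition hmuls As I : {linear tensors As -> hobj H I} :=
  match As return {linear tensors As -> hobj H I} with
  | [::] => hcast fset0 I
  | A :: As' => hmuls1 A As' I
  end.

Definition hcomuls As I : {linear hobj H I -> tensors As} :=
  match As return {linear hobj H I -> tensors As} with
  | [::] => hcast I fset0
  | A :: As' => hcomuls1 A As' I
  end.

Definition antipode I (x : hobj H I) : hobj H I :=
  \sum_(A \in [set A | setcomp I A]%classic)
    (-1) ^+ size A *: hmuls A I (hcomuls A I x).

End Antipode.

(* A linear order on I is given by the list of its elements in increasing
   order. *)
Definition linord (U : choiceType) (I : {fset U}) := seq_sub (permutations (enum_fset I)).

Section LinearOrders.
Variable K : fieldType.

Definition lobj (U : choiceType) (I : {fset U}) : lmodType K := {ffun linord I -> K^o}.

(* The basis vector of the linear order listed by s (0 if s lists none). *)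
Definition lvec (U : choiceType) (I : {fset U}) (s : seq U) : lobj I :=
  [ffun b : linord I => (val b == s)%:R].

Definition restr (U : choiceType) (A : {fset U}) (s : seq U) : seq U :=
  [seq i <- s | i \in A].

Section Structure.
Variables (U V : choiceType).
Implicit Types A B I : {fset U}.

Definition lext I (X : lmodType K) (F : seq U -> X) (v : lobj I) : X :=
  \sum_(a : linord I) (v a : K) *: F (val a).
Fact lext_linear I (X : lmodType K) (F : seq U -> X) : linear (@lext I X F).
Proof.
move=> k v w; rewrite /lext scaler_sumr -big_split; apply: eq_bigr => a _ /=.
by rewrite !ffunE scalerDl scalerA.
Qed.
HB.instance Definition _ I (X : lmodType K) (F : seq U -> X) :=
  GRing.isLinear.Build K _ _ _ (@lext I X F) (@lext_linear I X F).

Definition lmap I (J : {fset V}) (f : I -> J) : {linear lobj I -> lobj J} :=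
  lext (fun s => lvec J [seq val (f i) | i <- pmap insub s]).

Definition lunit (c : K^o) : lobj (fset0 : {fset U}) := c *: lvec fset0 [::].
Fact lunit_linear : linear lunit.
Proof. by move=> k b c; rewrite /lunit scalerDl scalerA. Qed.
HB.instance Definition _ := GRing.isLinear.Build K _ _ _ lunit lunit_linear.

Definition lconcat A B I (v : lobj A) (w : lobj B) : lobj I :=
  lext (fun s => lext (fun t => lvec I (s ++ t)) w) v.
Fact lconcat_bilin A B I : bilin (@lconcat A B I).
Proof.
split=> [w|v]; first exact: lext_linear.
move=> k w w'; rewrite /lconcat.
under [X in lext X]eq_fun do rewrite lext_linear.
rewrite /lext scaler_sumr -big_split; apply: eq_bigr => a _ /=.
by rewrite scalerDr !scalerA mulrC.
Qed.
Definition lmul A B I : tensor (lobj A) (lobj B) -> lobj I := tlift (@lconcat A B I).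
HB.instance Definition _ A B I :=
  GRing.isLinear.Build K _ _ _ (@lmul A B I) (tlift_linear (@lconcat_bilin A B I)).

Definition lcomul A B I : {linear lobj I -> tensor (lobj A) (lobj B)} :=
  lext (fun s => lvec A (restr A s) *t lvec B (restr B s)).

End Structure.

Definition linorders : hopf_data K := {|
  hobj := lobj;
  hmap := lmap;
  hunit := fun U => @lunit U;
  hmul := fun U A B I => @lmul U A B I;
  hcomul := lcomul
|}.

End LinearOrders.

Section Hadamard.
Variables (K : fieldType) (G H : hopf_data K).

Definition hadobj (U : choiceType) (I : {fset U}) : lmodType K :=
  tensor (hobj G I) (hobj H I).

Definition hadunit (U : choiceType) (c : K^o) : hadobj (fset0 : {fset U}) :=
  (c : K) *: (hunit G U 1 *t hunit H U 1).
Fact hadunit_linear U : linear (@hadunit U).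
Proof. by move=> k b c; rewrite /hadunit scalerDl scalerA. Qed.
HB.instance Definition _ U :=
  GRing.isLinear.Build K _ _ _ (@hadunit U) (@hadunit_linear U).

Definition hadamard : hopf_data K := {|
  hobj := hadobj;
  hmap := fun U V I J f => tmap (hmap G f) (hmap H f);
  hunit := fun U => @hadunit U;
  hmul := fun U A B I => tmap (hmul G A B I) (hmul H A B I) \o @tswap _ _ _ _ _;
  hcomul := fun U A B I => @tswap _ _ _ _ _ \o tmap (hcomul G A B I) (hcomul H A B I)
|}.

End Hadamard.

Definition vect_basis (K : fieldType) (V : lmodType K) (B : set V) : Prop :=
  (forall (s : seq V) (c : V -> K), uniq s -> (forall v, v \in s -> B v) ->
     \sum_(v <- s) c v *: v = 0 -> forall v, v \in s -> c v = 0) /\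
  (forall x : V, exists (s : seq V) (c : V -> K),
     (forall v, v \in s -> B v) /\ x = \sum_(v <- s) c v *: v).

(* The basis h[I] is a subset of H[I]; its structure of set species is the
   restriction of that of H. *)
Record linearized (K : fieldType) (H : hopf_data K)
    (h : forall (U : choiceType) (I : {fset U}), set (hobj H I)) : Prop := {
  lin_basis : forall (U : choiceType) (I : {fset U}), vect_basis (h U I);
  lin_map : forall (U V : choiceType) (I : {fset U}) (J : {fset V}) (f : I -> J) x,
    bijective f -> h U I x -> h V J (hmap H f x);
  lin_mul : forall (U : choiceType) (A B I : {fset U}) u v,
    decomp A B I -> h U A u -> h U B v -> h U I (hmul H A B I (u *t v));
  lin_comul : forall (U : choiceType) (A B I : {fset U}) x,
    decomp A B I -> h U I x ->
    hcomul H A B I x = 0 \/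
    exists u v, [/\ h U A u, h U B v & hcomul H A B I x = u *t v]
}.

Section Coefficients.
Variables (K : fieldType) (H : hopf_data K) (U : choiceType) (I : {fset U}).

Definition restr_comp (alpha : linord I) (A : seq {fset U}) : seq U :=
  flatten [seq restr B (val alpha) | B <- A].

Definition antipode_comps (alpha : linord I) (x : hobj H I)
    (beta : linord I) (y : hobj H I) : set (seq {fset U}) :=
  [set A | [/\ setcomp I A, hcomuls H A I x != 0, restr_comp alpha A = val beta
             & hmuls H A I (hcomuls H A I x) = y]]%classic.

Definition antipode_coef (alpha : linord I) (x : hobj H I)
    (beta : linord I) (y : hobj H I) : K :=
  \sum_(A \in antipode_comps alpha x beta y) ((-1) ^+ size A : K).

End Coefficients.

(* Main.v *)
(** For C included in I let P_C = mu_{C,I\C} Delta_{C,I\C}.  Since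
    Delta_{C,I\C} mu_{C,I\C} = id, P_C is idempotent; along a chain of subsets the
    P_C commute, and mu_A Delta_A is the product of the P_C over the proper partial
    unions C of A.  A composition A with alpha_A = beta consists of intervals of
    beta, so it is a set of cut positions, and x_A = P_{i_1} ... P_{i_k} x where
    P_i cuts beta after its i-th element.

    Let M be the set of cuts fixing y.  Because P_r and P_k act on different tensor
    factors once a cut i between them has been made, the condition x_A = y,
    alpha_A = beta on a set of cuts in M splits into conditions good(i, j) on its
    consecutive cuts i < j, and good(i, j) implies good(i', j) for i < i' < j in M.
    Hence the coefficient is f(|I|), where f(0) = 1 and
    f(j) = - sum_{i < j, good(i, j)} f(i).  The sum runs over a window ending at
    j - 1, so by induction the nonzero values of f are 1 and -1 alternately, and
    every window sum is 0, 1 or -1. *)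

Require Import Defs.
From HB Require Import structures.
From mathcomp Require Import all_boot all_order all_algebra.
From mathcomp Require Import finmap boolp classical_sets cardinality fsbigop.

Set Implicit Arguments.
Unset Strict Implicit.
Unset Printing Implicit Defensive.

Import GRing.Theory.
Local Open Scope ring_scope.

(** * Signed sums over cut sets *)

Section AlternatingWindows.
Variable K : pzRingType.

(** By the third hypothesis, on the support of [f] the indices that are good for [m] form a final
    stretch of those below [m]. So [f m.+1] is minus the sum of [f] over a window ending at [m]. *)
Lemma alternating_recurrence_bound (f : nat -> K) (good : rel nat) :
    f 0%N = 1 ->
    (forall m, f m.+1 = - \sum_(0 <= i < m.+1 | good i m.+1) f i) ->
    (forall a i m, (a < i < m)%N -> good a m -> f a != 0 -> f i != 0 -> good i m) ->
  forall m, f m \in [:: 1; -1; 0].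
Proof.
move=> f0 fS goodl.
(* the nonzero values of f alternate in sign, so a window ending at m sums to 0
   or to the last nonzero value before m *)
have windows m : exists2 e : K, e = 1 \/ e = -1 &
    forall a, \sum_(a <= i < m.+1) f i \in [:: 0; e].
  elim: m => [|m [e e1 We]].
    exists 1; first by left.
    case=> [|a]; first by rewrite big_nat1 f0 !inE eqxx orbT.
    by rewrite big_geq // !inE eqxx.
  have fm : f m.+1 \in [:: 0; - e].
    (* The window starts at the least good index in the support of [f]; if there is none, the empty
       window starting at [m.+1] serves. *)
    have [a Ea] : exists a,
        \sum_(0 <= i < m.+1 | good i m.+1) f i = \sum_(a <= i < m.+1) f i.
      case: (pselect (exists a, [&& (a < m.+1)%N, good a m.+1 & f a != 0])) => [ex|nex].
        case: (ex_minnP ex) => a /and3P[am ga fa] amin; exists a.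
        rewrite (big_cat_nat (n := a)) //=; last exact: ltnW.
        rewrite big_nat_cond big1 ?add0r => [|i /andP[/andP[_ ia] gi]].
          rewrite big_mkcond; apply: eq_big_nat => i /andP[ai im].
          case: ifPn => // ngi; apply/esym/eqP; apply: contraNT ngi => fi.
          move: ai; rewrite leq_eqVlt => /predU1P[<- //|ai].
          by apply: (goodl a) => //; rewrite ai.
        apply/eqP; apply: contraLR (ia) => fi; rewrite -leqNgt; apply: amin.
        by rewrite gi fi (ltn_trans ia am).
      exists m.+1; rewrite [RHS]big_geq // big_nat_cond big1 // => i /andP[im gi].
      apply/eqP; apply: contrapT => /negP fi; apply: nex; exists i.
      by rewrite gi fi; case/andP: im => _ ->.
    have := We a; rewrite fS Ea !inE => /orP[] /eqP ->; rewrite ?oppr0 ?eqxx ?orbT //.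
  (* A nonzero [f m.+1] flips the sign of [e]: the window sums [0] and [e] become [- e] and [0]. *)
  have [fm0|fme] : f m.+1 = 0 \/ f m.+1 = - e.
    by move: fm; rewrite !inE => /orP[] /eqP; [left|right].
  - exists e => // a; case: (leqP a m.+1) => am.
      by rewrite big_nat_recr //= fm0 addr0.
    by rewrite big_geq // !inE eqxx.
  - exists (- e); first by case: e1 => ->; [right|left]; rewrite ?opprK.
    move=> a; case: (leqP a m.+1) => am; last by rewrite big_geq // !inE eqxx.
    rewrite big_nat_recr //= fme; have := We a.
    by rewrite !inE => /orP[] /eqP ->; rewrite ?add0r ?subrr eqxx ?orbT.
(* The window reduced to the index [m] gives [f m] itself. *)
move=> m; have [e e1 /(_ m)] := windows m; rewrite big_nat1 !inE.
by case: e1 => -> /orP[] ->; rewrite ?orbT.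
Qed.

End AlternatingWindows.

(** The increasing lists of interior cuts of a word of length [n.+1], with entries from [1] to [n];
    the outer cuts [0] and [n.+1] stay implicit. *)
Fixpoint cutlists n : seq (seq nat) :=
  if n is m.+1 then cutlists m ++ [seq rcons p m.+1 | p <- cutlists m]
  else [:: [::]].

Lemma mem_cutlists n p : (p \in cutlists n) = path ltn 0 (rcons p n.+1).
Proof.
elim: n p => [|n IH] p /=.
  case: p => [|i p] //=; rewrite inE /=; apply/esym/negbTE.
  rewrite negb_and -leqNgt leqn0; case: eqP => //= i0.
  rewrite rcons_path; apply/negP => /andP[ip] /=; rewrite ltnS leqn0 => /eqP l0.
  have : all (ltn 0) (i :: p).
    by apply: (order_path_min ltn_trans); rewrite /= ip; case: (i) i0.
  by move=> /allP /(_ _ (mem_last i p)); rewrite l0.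
rewrite mem_cat {1}IH; case: (lastP p) => [|q j].
  by [].
have -> : (rcons q j \in [seq rcons p0 n.+1 | p0 <- cutlists n]) =
    (j == n.+1) && path ltn 0 (rcons q j).
  apply/mapP/andP => [[r rn /rcons_inj[-> ->]]|[/eqP -> qj]].
    by rewrite eqxx -IH.
  by exists q; rewrite ?IH.
rewrite !(rcons_path _ _ (rcons q j)) !last_rcons /=.
by rewrite [(j < n.+2)%N]ltnS [(j <= n.+1)%N]leq_eqVlt andb_orr orbC [_ && path _ _ _]andbC.
Qed.

Lemma cutlists_uniq n : uniq (cutlists n).
Proof.
elim: n => //= n IH; rewrite cat_uniq IH map_inj_uniq ?IH; last first.
  by move=> p q /rcons_inj[].
rewrite andbT /=; apply/hasPn => _ /mapP[q _ ->]; rewrite mem_cutlists.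
by rewrite rcons_path last_rcons /= ltnn andbF.
Qed.

Section CutSums.
Variable K : pzRingType.

(** Splitting off the last interior cut turns the signed sum into the recurrence of
    [alternating_recurrence_bound]. The exponent counts the blocks, one more than the interior
    cuts. *)
Lemma path_sum_bound (good : rel nat) :
    (forall a i m, (a < i < m)%N -> good a m ->
       (exists2 b, (b < i)%N & good b i) -> good i m) ->
  forall n, \sum_(p <- cutlists n | path good 0 (rcons p n.+1)) (-1) ^+ (size p).+1
     \in [:: 1; -1; 0 : K].
Proof.
move=> goodl n.
(* In [h n m] the interior cuts range up to [n] and the path ends at [m]; [f 0 = 1] stands for the
   path without any step. *)
pose h n m : K := \sum_(p <- cutlists n | path good 0 (rcons p m)) (-1) ^+ (size p).+1.
pose f m : K := if m is m'.+1 then h m' m else 1.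
have hE k m : h k m = - \sum_(0 <= i < k.+1 | good i m) f i.
  elim: k => [|k IH].
    rewrite /h /= big_mkcond big_seq1 /= andbT big_mkcond big_nat1 /= expr1.
    by case: ifP; rewrite ?oppr0.
  rewrite big_mkcond big_nat_recr //= -big_mkcond /= opprD -IH.
  rewrite {1}/h /= big_cat /= big_map; congr (_ + _).
  under eq_bigl do rewrite rcons_path last_rcons.
  case: ifPn => gk; last by rewrite big1 ?oppr0 // => p /andP[].
  under eq_bigl do rewrite andbT.
  under eq_bigr do rewrite size_rcons exprS mulN1r.
  by rewrite sumrN.
apply: (alternating_recurrence_bound (f := f) (good := good) _ _ _ n.+1) => //.
  by move=> m; rewrite -hE.
move=> a i m aim gam _ fi; apply: (goodl a) => //.
(* A nonzero [f i] with [i > 0] has a term in its recurrence, which supplies the predecessor [b]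
   that [goodl] asks for. *)
case: i aim fi => [|i] /andP[ai im] //; rewrite /f hE oppr_eq0 => nz.
have : has (good^~ i.+1) (iota 0 i.+1).
  apply: contraNT nz => /hasPn no; rewrite big_nat_cond big1 // => j.
  rewrite /= => /andP[ji gj]; have := no j; rewrite mem_iota ji gj => /(_ isT); done.
by case/hasP => b; rewrite mem_iota => /andP[_ bi] gb; exists b.
Qed.

End CutSums.

(* [P i] abstracts the projection of H[I] that cuts beta after its i-th element,
   and [Q] the set of basis vectors and 0. *)
Section ChainOperators.
Variables (K : pzRingType) (X : eqType) (z0 : X) (Q : X -> Prop) (P : nat -> X -> X).
Hypotheses (PC : forall i j z, P i (P j z) = P j (P i z))
  (PP : forall i z, P i (P i z) = P i z) (PQ : forall i z, Q z -> Q (P i z))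
  (Pz : forall i, P i z0 = z0) (P0 : forall z, P 0 z = z).
(** Cuts [r] and [k] on opposite sides of [i] act on different tensor factors once the cut [i] is
    made; [cutproj_cancel_lt] and [cutproj_cancel_gt] supply this. *)
Hypothesis Pcancel : forall r i k z, Q z -> (r < i < k)%N || (k < i < r)%N ->
  P r (P i (P k z)) = P i (P k z) -> P i (P k z) <> z0 -> P r (P i z) = P i z.

Let PS p z := foldl (fun z i => P i z) z p.

Lemma chain_comm i p z : P i (PS p z) = PS p (P i z).
Proof. by elim: p z => //= j p IH z; rewrite IH PC. Qed.

Lemma chain_commS p q z : PS p (PS q z) = PS q (PS p z).
Proof. by elim: p z => //= i p IH z; rewrite chain_comm IH. Qed.

Lemma chain_absorb i p z : i \in p -> P i (PS p z) = PS p z.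
Proof.
elim: p z => //= j p IH z; rewrite inE => /predU1P[->|/IH //].
by rewrite chain_comm PP.
Qed.

Lemma chain_zero p : PS p z0 = z0.
Proof. by elim: p => //= i p; rewrite Pz. Qed.

Lemma chain_Q p z : Q z -> Q (PS p z).
Proof. by elim: p z => //= i p IH z Qz; exact/IH/PQ. Qed.

(** [Pcancel] removes the cuts of [t] one at a time; each intermediate value is nonzero because a
    further projection of it is. *)
Lemma chain_cancel r i t z : Q z ->
    {in t, forall k, (r < i < k)%N || (k < i < r)%N} ->
    P r (P i (PS t z)) = P i (PS t z) -> P i (PS t z) <> z0 ->
  P r (P i z) = P i z.
Proof.
elim: t z => //= k t IH z Qz rik E nz.
have Qt := chain_Q t Qz.
apply: IH => // [j jt||].
- by apply: rik; rewrite inE jt orbT.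
- apply: (Pcancel (k := k)) => //; rewrite ?rik ?mem_head //.
  + by rewrite chain_comm.
  + by rewrite chain_comm.
- by move=> E0; apply: nz; rewrite -chain_comm PC E0 Pz.
Qed.

Variables (N : nat) (x y : X) (inc : rel nat).
Hypotheses (PN : forall z, P N z = z) (Qx : Q x) (nzy : y <> z0).
Hypothesis incl : forall a i m, (a <= i < m)%N -> inc a m -> inc i m.

Let fixed i := P i y == y.
(* [good i j] : no cut is needed strictly between the cuts i and j *)
Let good i j := [&& (i < j)%N, inc i j, fixed i, fixed j &
  all (fun r => fixed r ==> (P r (P i (P j x)) == P i (P j x))) (iota i.+1 (j - i.+1))].

Lemma good_absorb i j r : good i j -> fixed r -> (i < r < j)%N ->
  P r (P i (P j x)) = P i (P j x).
Proof.
move=> /and5P[ij _ _ _ /allP h] Mr /andP[ir rj].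
apply/eqP; apply: (implyP (h r _)) => //.
by rewrite mem_iota ir subnKC.
Qed.

Lemma chain_fixed p : all fixed p -> PS p y = y.
Proof. by elim: p => //= i p IH /andP[/eqP -> /IH]. Qed.

(** The absorption given by [good a m] carries an extra factor [P a], which [Pcancel] drops since
    [a] and [r] lie on opposite sides of [i]. *)
Lemma good_lclosed p0 : PS p0 x = y -> forall a i m, (a < i < m)%N -> good a m ->
  fixed i -> good i m.
Proof.
move=> Ep0 a i m /andP[ai im] gam Mi; have /and5P[_ iam Ma Mm _] := gam.
apply/and5P; split=> //; first by apply: incl iam; rewrite (ltnW ai).
apply/allP => r; rewrite mem_iota subnKC // => /andP[ir rm].
apply/implyP => Mr; apply/eqP.
apply: (Pcancel (k := a)); first exact: PQ.
- by rewrite ai ir orbT.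
- by rewrite (PC r i) good_absorb // (ltn_trans ai).
(* Applying [PS p0] to this product of projections of [x] gives [y] back, so the product is
   nonzero. *)
- move=> E0; apply: nzy; rewrite -(chain_fixed (p := [:: m; a; i])); last first.
    by rewrite /= Mm Ma Mi.
  by rewrite -{1}Ep0 chain_commS /= E0 chain_zero.
Qed.

Lemma good_path_absorb a s r : path good a s -> fixed r -> (a < r < last a s)%N ->
  P r (PS (a :: s) x) = PS (a :: s) x.
Proof.
elim: s a => [|j s IH] a /=; first by move=> _ _ /andP[/ltn_trans h /h]; rewrite ltnn.
move=> /andP[gaj ps] Mr /andP[ar rl].
case: (ltngtP r j) => [rj|jr|->].
- by rewrite chain_comm [P j _]PC good_absorb // ?ar.
- have := IH j ps Mr; rewrite jr rl /= => /(_ isT) E.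
  by rewrite PC -chain_comm PC E.
- by rewrite chain_comm PP.
Qed.

(* The condition PS p x = y is local: by [Pcancel] it can be tested on each pair
   of consecutive cuts separately. *)
Lemma chain_path_good p0 n p : PS p0 x = y -> p0 \in cutlists n -> N = n.+1 ->
  p \in cutlists n ->
  path good 0 (rcons p N) = path inc 0 (rcons p N) && (PS p x == y).
Proof.
move=> Ep0 p0n EN; rewrite !mem_cutlists -EN in p0n * => pn.
have E0 q : PS q x = PS (0 :: rcons q N) x.
  by rewrite /= P0 /PS foldl_rcons PN.
have memM q : PS q x = y -> all fixed q.
  by move=> Eq; apply/allP => i iq; rewrite /fixed -Eq chain_absorb.
have MN : fixed N by rewrite /fixed PN.
have M0 : fixed 0 by rewrite /fixed P0.
apply/idP/andP => [pg|[pi /eqP Ep]].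
  split; first by apply: sub_path pg => i j /and5P[].
  have Mp : all fixed p.
    have H a s : path good a s -> all fixed s.
      by elim: s a => //= j s IH a /andP[/and5P[_ _ _ -> _] /IH].
    by have := H _ _ pg; rewrite all_rcons => /andP[].
  (* The cuts of [p] fix [y], so [y = PS p (PS p0 x) = PS p0 (PS p x)]; each cut of [p0] fixes [y]
     and is therefore absorbed by the good path. *)
  apply/eqP; rewrite -[RHS](chain_fixed Mp) -Ep0 chain_commS.
  have /allP Mp0 := memM _ Ep0.
  have : {in p0, forall r, (0 < r < N)%N}.
    move=> r rp0; have := order_path_min ltn_trans p0n.
    rewrite all_rcons => /andP[_ /allP /(_ _ rp0) /= ->].
    have := p0n; rewrite -cats1 /= path_sortedE; last exact: ltn_trans.
    rewrite cats1 => /andP[_]; rewrite -rev_sorted rev_rcons /= path_sortedE.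
      by case/andP => /allP /(_ r); rewrite mem_rev => /(_ rp0).
    by move=> ? ? ? /= h1 h2; apply: ltn_trans h2 h1.
  elim: (p0) Mp0 => //= r q IH Mq rq.
  have -> : P r (PS p x) = PS p x.
    rewrite (E0 p); apply: good_path_absorb => //; first by apply: Mq; rewrite mem_head.
    by rewrite last_rcons rq ?mem_head.
  by apply: IH => k kq; [apply: Mq|apply: rq]; rewrite inE kq orbT.
have Epp : PS (0 :: rcons p N) x = y by rewrite -E0.
have MpN : all fixed (0%N :: rcons p N) by rewrite /= M0 all_rcons MN memM.
(* Here [t] collects the cuts already passed. For the gap from [a] to [j], [chain_cancel] is used
   twice: first to drop the cuts [s] to the right of [j], then the cuts [t] to the left of [a]. *)
suff H a s t : path ltn a s -> path inc a s -> {in t, forall k, (k < a)%N} ->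
    all fixed (a :: s) -> PS (t ++ a :: s) x = y -> path good a s.
  by apply: (H 0%N _ [::]).
elim: s a t => //= j s IH a t /andP[aj pjs] /andP[iaj ijs] ta /and3P[Ma Mj Ms] E.
rewrite [X in _ && X](IH j (a :: t)) ?Mj //; last 2 first.
- move=> k; rewrite inE => /predU1P[-> //|/ta ka]; exact: ltn_trans aj.
- by rewrite -E /PS !foldl_cat /=; congr (foldl _ (P j _) s); exact/esym/chain_comm.
rewrite andbT; apply/and5P; split=> //; apply/allP => r.
rewrite mem_iota subnKC // => /andP[ar rj]; apply/implyP => Mr; apply/eqP.
have E1 : P j (PS s (P a (PS t x))) = y.
  by rewrite chain_comm -E /PS foldl_cat.
have E2 : P r (P j (PS s (P a (PS t x)))) = P j (PS s (P a (PS t x))).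
  by rewrite E1; exact/eqP.
have Qt := chain_Q t Qx.
have E3 : P r (P j (P a (PS t x))) = P j (P a (PS t x)).
  apply: (chain_cancel (t := s)) E2 _; rewrite ?E1 //; first exact: PQ.
  move=> k ks; rewrite rj /=.
  by have /allP /(_ _ ks) /= -> := order_path_min ltn_trans pjs.
have Eaj : P a (PS t (P j x)) = P j (P a (PS t x)).
  by rewrite -chain_comm PC.
apply: (chain_cancel (t := t)); rewrite ?Eaj //; first exact: PQ.
  by move=> k /ta ->; rewrite ar orbT.
move=> E5; apply: nzy; rewrite -E1 chain_comm E5.
exact: chain_zero.
Qed.

(** If no cut list yields [y] the sum is empty; otherwise one such list [p0] makes the condition
    local and [path_sum_bound] applies. *)
Lemma chain_sum_bound n : N = n.+1 ->
  \sum_(p <- cutlists n | path inc 0 (rcons p N) && (PS p x == y)) (-1) ^+ (size p).+1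
     \in [:: 1; -1; 0 : K].
Proof.
move=> EN; case: (boolP (has (fun p => PS p x == y) (cutlists n))) => [|/hasPn no].
  case/hasP => p0 p0n /eqP Ep0.
  rewrite big_seq_cond (eq_bigl (fun p => (p \in cutlists n) && path good 0 (rcons p N))).
    rewrite -big_seq_cond EN; apply: path_sum_bound => a i m aim gam [b _].
    by case/and5P => _ _ _ Mi _; apply: good_lclosed Ep0 _ _ _ aim gam Mi.
  by move=> p /=; case: (boolP (p \in _)) => //= pn; rewrite (chain_path_good Ep0 p0n).
rewrite big_seq_cond big1 ?inE ?eqxx ?orbT // => p /andP[pn /andP[_]].
by rewrite (negbTE (no _ pn)).
Qed.

End ChainOperators.

(** * Hopf-monoid projections *)

Section TensorElements.
Local Open Scope fset_scope.
Local Open Scope ring_scope.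
Variable K : fieldType.
Implicit Types V W : lmodType K.

Lemma tens0l V W (w : W) : 0 *t w = 0 :> tensor V W.
Proof. by rewrite -(scale0r 0) tensZl scale0r. Qed.

Lemma tens0r V W (v : V) : v *t 0 = 0 :> tensor V W.
Proof. by rewrite -(scale0r 0) tensZr scale0r. Qed.

(** The zero tensor is covered by the first premise, being [0 *t 0]. *)
Lemma tens_ind V W (P : tensor V W -> Prop) :
  (forall v w, P (v *t w)) -> (forall a b, P a -> P b -> P (a + b)) ->
  forall a, P a.
Proof.
move=> Pt PD a; rewrite [a]tens_sum; elim/big_ind: _ => //.
by rewrite -(tens0l V (0 : W)).
Qed.

Lemma tmap_compl V V' V'' W (f : {linear V' -> V''}) (g : {linear V -> V'})
    (a : tensor V W) :
  tmap (f \o g) idfun a = tmap f idfun (tmap g idfun a).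
Proof.
by elim/tens_ind: a => [v w|a b Ea Eb]; [rewrite !tmapE|rewrite !linearD /= Ea Eb].
Qed.

Lemma tmap_compr V W W' W'' (f : {linear W' -> W''}) (g : {linear W -> W'})
    (a : tensor V W) :
  tmap idfun (f \o g) a = tmap idfun f (tmap idfun g a).
Proof.
by elim/tens_ind: a => [v w|a b Ea Eb]; [rewrite !tmapE|rewrite !linearD /= Ea Eb].
Qed.

Lemma basis_neq0 V (B : set V) w : vect_basis B -> B w -> w <> 0.
Proof.
move=> [ind _] Bw w0.
have /(_ w) : forall v, v \in [:: w] -> (fun _ => 1 : K) v = 0.
  apply: ind => //; first by move=> v; rewrite inE => /eqP ->.
  by rewrite big_seq1 scale1r.
by rewrite inE eqxx => /(_ isT) /eqP; rewrite oner_eq0.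
Qed.

(** The span [N] of the other basis vectors is a complement of the line of [w]. So [phi x] is the
    only scalar with [x - phi x *: w] in [N], and this uniqueness makes [phi] linear. *)
Lemma basis_dual V (B : set V) w : vect_basis B -> B w ->
  exists phi : {linear V -> K^o}, phi w = 1.
Proof.
move=> [ind span] Bw.
pose N (z : V) := exists2 l : seq (K * V), (forall q, q \in l -> B q.2 /\ q.2 != w)
  & z = \sum_(q <- l) q.1 *: q.2.
have ND z z' : N z -> N z' -> N (z + z').
  move=> [l lB ->] [l' lB' ->]; exists (l ++ l'); last by rewrite big_cat.
  by move=> q; rewrite mem_cat => /orP[/lB|/lB'].
have NZ k z : N z -> N (k *: z).
  move=> [l lB ->]; exists [seq (k * q.1, q.2) | q <- l].
    by move=> q' /mapP[q /lB ? ->].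
  by rewrite scaler_sumr big_map; apply: eq_bigr => q _; rewrite scalerA.
have Nw k : N (k *: w) -> k = 0.
  move=> [l lB Ew]; pose s := undup [seq q.2 | q <- l].
  have ws : w \notin s.
    by rewrite mem_undup; apply/mapP => -[q /lB[_ /eqP qw] /esym].
  (* Repeated vectors in [l] are merged before linear independence is applied, with coefficient
     [- k] at [w]. *)
  pose c v : K := if v == w then - k else \sum_(q <- l | q.2 == v) q.1.
  have /(_ w) : forall v, v \in w :: s -> c v = 0.
    apply: ind; first by rewrite /= ws undup_uniq.
      move=> v; rewrite inE mem_undup => /predU1P[->//|/mapP[q /lB[Bq _] ->]//].
    rewrite big_cons {1}/c eqxx scaleNr Ew addrC; apply/eqP; rewrite subr_eq0.
    have -> : \sum_(v <- s) c v *: v = \sum_(v <- s) \sum_(q <- l | q.2 == v) q.1 *: q.2.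
      rewrite big_seq [RHS]big_seq; apply: eq_bigr => v vs.
      have /negbTE vw : v != w by apply: contraNneq ws => <-.
      by rewrite /c vw scaler_suml; apply: eq_bigr => q /eqP ->.
    rewrite (exchange_big_dep predT) //=; apply/eqP.
    rewrite big_seq [RHS]big_seq; apply: eq_bigr => q ql.
    rewrite big_mkcond (bigD1_seq q.2) ?undup_uniq ?mem_undup ?map_f //= eqxx.
    by rewrite big1 ?addr0 // => v; rewrite eq_sym => /negbTE ->.
  by rewrite mem_head /c eqxx => /(_ isT) /eqP; rewrite oppr_eq0 => /eqP.
have exN x : exists k : K, N (x - k *: w).
  have [s [c [sB ->]]] := span x.
  exists (\sum_(v <- s | v == w) c v).
  exists [seq (c v, v) | v <- s & v != w].
    by move=> q /mapP[v]; rewrite mem_filter => /andP[vw /sB ?] ->.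
  rewrite big_map big_filter (bigID (fun v => v == w)) /=.
  rewrite (eq_bigr (fun v => c v *: w)) => [|v /eqP -> //].
  by rewrite -scaler_suml addrC addrK.
have [phi phiP] := choice exN.
have phiE x k : N (x - k *: w) -> phi x = k.
  move=> Nk; apply/eqP; rewrite -subr_eq0; apply/eqP/Nw.
  rewrite scalerBl (_ : _ - _ = (x - k *: w) + (-1) *: (x - phi x *: w)).
    exact/ND/NZ.
  by rewrite scaleN1r opprB [RHS]addrC addrA subrK.
have phil : linear (phi : V -> K^o).
  move=> k u v; apply: phiE.
  rewrite (_ : _ - _ = k *: (u - phi u *: w) + (v - phi v *: w)).
    by apply: ND => //; apply: NZ.
  by rewrite scalerBr scalerDl scalerA opprD addrACA.
pose phiL := GRing.isLinear.Build K V K^o _ phi phil.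
pose phil' : {linear V -> K^o} := HB.pack phi phiL.
exists phil'; apply: phiE; rewrite scale1r subrr.
by exists [::]; rewrite ?big_nil.
Qed.

(** Contracting the second factor with the functional of [basis_dual] leaves the first one. *)
Lemma tens_cancelr V W (B : set W) w (u u' : V) : vect_basis B -> B w ->
  u *t w = u' *t w -> u = u'.
Proof.
move=> bB Bw E; have [phi phiw] := basis_dual bB Bw.
have bf : bilin (fun (v : V) (z : W) => (phi z : K) *: v).
  split=> [z|v] k a b; first by rewrite scalerDr !scalerA mulrC.
  by rewrite (linearP phi) scalerDl -scalerA.
by have := tlift_tens u w bf; rewrite E tlift_tens // phiw !scale1r.
Qed.

Lemma tens_cancell V W (B : set V) v (u u' : W) : vect_basis B -> B v ->
  v *t u = v *t u' -> u = u'.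
Proof.
move=> bB Bv E; have [phi phiv] := basis_dual bB Bv.
have bf : bilin (fun (z : V) (w : W) => (phi z : K) *: w).
  split=> [w|z] k a b; last by rewrite scalerDr !scalerA mulrC.
  by rewrite (linearP phi) scalerDl -scalerA.
by have := tlift_tens v u bf; rewrite E tlift_tens // phiv !scale1r.
Qed.

End TensorElements.

(** * Decompositions of finite sets *)

Section DecompFacts.
Local Open Scope fset_scope.
Local Open Scope ring_scope.
Variable U : choiceType.
Implicit Types A B C D E I : {fset U}.

Lemma decompP A B I : reflect
  (forall i, (i \in I) = (i \in A) || (i \in B) /\ ~~ ((i \in A) && (i \in B)))
  (decomp A B I).
Proof.
apply: (iffP andP) => [[/eqP AB0 /eqP <-] i|h].
  by split; rewrite ?in_fsetU // -in_fsetI AB0.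
split; apply/eqP/fsetP => i; rewrite ?in_fsetI ?in_fsetU ?in_fset0.
  by apply/negbTE; case: (h i).
by case: (h i).
Qed.

Lemma decompD C I : C `<=` I -> decomp C (I `\` C) I.
Proof.
move=> /fsubsetP CI; apply/decompP => i; rewrite !in_fsetD.
by have := CI i; case: (i \in C); case: (i \in I) => // /(_ isT).
Qed.

Lemma decompDD C E I : C `<=` E -> E `<=` I -> decomp (E `\` C) (I `\` E) (I `\` C).
Proof.
move=> /fsubsetP CE /fsubsetP EI; apply/decompP => i; rewrite !in_fsetD.
have := CE i; have := EI i.
by case: (i \in C); case: (i \in E); case: (i \in I) => // h1 h2;
  first [have := h1 isT | have := h2 isT].
Qed.

Lemma setcomp_cons I A As : setcomp I (A :: As) ->
  [/\ A != fset0, A `<=` I & setcomp (I `\` A) As].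
Proof.
rewrite /setcomp inE negb_or pairwise_cons big_cons.
case/and3P => /andP[A0 nA] /andP[dA dAs] /eqP UI.
split; first by rewrite eq_sym.
  by rewrite -UI fsubsetUl.
apply/and3P; split=> //; apply/eqP; rewrite -UI; apply/fsetP => i.
rewrite in_fsetD in_fsetU; case: (boolP (i \in A)) => //= iA.
apply/negP => /bigfcupP[C /andP[CB _] iC].
by have /allP /(_ _ CB) /fdisjointP /(_ _ iA) /negP := dA.
Qed.

Lemma setcomp_bigcup I As : setcomp I As -> \bigcup_(B <- As) B = I.
Proof. by case/and3P => _ _ /eqP. Qed.

End DecompFacts.

(** * The projections given by a coproduct followed by a product *)

Section HopfProjections.
Local Open Scope fset_scope.
Local Open Scope ring_scope.
Variables (K : fieldType) (H : hopf_data K).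
Hypothesis hopfH : connected_hopf_monoid H.
Variable U : choiceType.
Implicit Types A B C D E I : {fset U}.

Definition hproj A B I : {linear hobj H I -> hobj H I} := hmul H A B I \o hcomul H A B I.

Lemma hprojE A B I z : hproj A B I z = hmul H A B I (hcomul H A B I z).
Proof. by []. Qed.

(** Naming the four intersections by sets merely equal to them avoids transport between the spaces
    of equal sets. *)
Lemma hcompat_eq A B C D I AC AD BC BD : decomp A B I -> decomp C D I ->
    A `&` C = AC -> A `&` D = AD -> B `&` C = BC -> B `&` D = BD ->
  forall t, hcomul H C D I (hmul H A B I t) =
    tmap (hmul H AC BC C) (hmul H AD BD D)
      (tswap (tmap (hcomul H AC AD A) (hcomul H BC BD B) t)).
Proof. by move=> dAB dCD <- <- <- <- t; exact: (hcompat hopfH). Qed.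

(** The mixed intersections are empty, so the compatibility axiom involves only units and
    counits. *)
Lemma hcomul_hmul A B I t : decomp A B I -> hcomul H A B I (hmul H A B I t) = t.
Proof.
move=> dAB; have /andP[/eqP AB0 _] := dAB.
rewrite (hcompat_eq dAB dAB (fsetIid _) AB0 (etrans (fsetIC _ _) AB0) (fsetIid _)).
elim/tens_ind: t => [a b|a b Ea Eb]; last by rewrite !linearD /= Ea Eb.
rewrite tmapE (hcomul_counitr hopfH) (hcomul_counitl hopfH) tswapE tmapE.
by rewrite (hmul_unitr hopfH) (hmul_unitl hopfH).
Qed.

(** Here [I] is split into [A], [C], [D] in this order. The later cut meets [A] and [D] in the empty
    set, so it acts only on the second factor; associativity reassembles the product. *)
Lemma hproj_hmulr A B C D E I t :
    decomp A B I -> decomp C D B -> decomp A C E -> decomp E D I ->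
  hproj E D I (hmul H A B I t) = hmul H A B I (tmap idfun (hproj C D B) t).
Proof.
move=> dAB dCD dAC dED.
have AE : A `&` E = A.
  apply/fsetP => i; have := decompP _ _ _ dAC i; rewrite in_fsetI => -[-> _].
  by case: (i \in A).
have AD : A `&` D = fset0.
  apply/fsetP => i; have [_] := decompP _ _ _ dAB i; have [-> _] := decompP _ _ _ dCD i.
  by rewrite in_fsetI in_fset0; case: (i \in A); case: (i \in D); rewrite ?orbT.
have BE : B `&` E = C.
  apply/fsetP => i; have [_] := decompP _ _ _ dAB i; have [] := decompP _ _ _ dCD i.
  have [] := decompP _ _ _ dAC i; rewrite in_fsetI => -> _ -> _.
  have [] := decompP _ _ _ dCD i; rewrite orbC.
  by case: (i \in A); case: (i \in C); case: (i \in D) => //=; rewrite ?orbT ?andbF.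
have BD : B `&` D = D.
  apply/fsetP => i; have := decompP _ _ _ dCD i; rewrite in_fsetI => -[-> _].
  by case: (i \in D); rewrite ?orbT ?andbF.
rewrite /hproj /= (hcompat_eq dAB dED AE AD BE BD).
elim/tens_ind: t => [a b|a b Ea Eb]; last by rewrite !linearD /= Ea Eb.
rewrite !tmapE (hcomul_counitr hopfH) /=.
elim/tens_ind: (hcomul H C D B b) => [c d|s s' Es Es']; last first.
  by rewrite !(tensDr, linearD) /= Es Es'.
rewrite tswapE tmapE (hmul_unitl hopfH).
have := hmulA hopfH dAC dCD dED dAB ((a *t c) *t d).
by rewrite /= tmapE tassocE tmapE.
Qed.

Lemma hproj_hmull A B C D E I t :
    decomp A B I -> decomp C D A -> decomp D B E -> decomp C E I ->
  hproj C E I (hmul H A B I t) = hmul H A B I (tmap (hproj C D A) idfun t).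
Proof.
move=> dAB dCD dDB dCE.
have AC : A `&` C = C.
  apply/fsetP => i; have := decompP _ _ _ dCD i; rewrite in_fsetI => -[-> _].
  by case: (i \in C); rewrite ?orbT ?andbF.
have AE : A `&` E = D.
  apply/fsetP => i; have [_] := decompP _ _ _ dAB i; have [] := decompP _ _ _ dCD i.
  have [] := decompP _ _ _ dDB i; rewrite in_fsetI => -> _ -> _.
  have [] := decompP _ _ _ dCD i; rewrite orbC.
  by case: (i \in B); case: (i \in C); case: (i \in D) => //=; rewrite ?orbT ?andbF.
have BC : B `&` C = fset0.
  apply/fsetP => i; have [_] := decompP _ _ _ dAB i; have [-> _] := decompP _ _ _ dCD i.
  by rewrite in_fsetI in_fset0; case: (i \in B); case: (i \in C); rewrite ?orbT.
have BE : B `&` E = B.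
  apply/fsetP => i; have := decompP _ _ _ dDB i; rewrite in_fsetI => -[-> _].
  by case: (i \in B); rewrite ?orbT.
rewrite /hproj /= (hcompat_eq dAB dCE AC AE BC BE).
elim/tens_ind: t => [a b|a b Ea Eb]; last by rewrite !linearD /= Ea Eb.
rewrite !tmapE (hcomul_counitl hopfH) /=.
elim/tens_ind: (hcomul H C D A a) => [c d|s s' Es Es']; last first.
  by rewrite !(tensDl, linearD) /= Es Es'.
rewrite tswapE tmapE (hmul_unitr hopfH).
have := hmulA hopfH dCD dDB dAB dCE ((c *t d) *t b).
by rewrite /= tmapE tassocE tmapE.
Qed.

(** Both composites are the threefold coproduct followed by the threefold product over [A], [C],
    [D], bracketed in the two possible ways. *)
Lemma hprojC A B C D E I z :
    decomp A B I -> decomp C D B -> decomp A C E -> decomp E D I ->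
  hproj A B I (hproj E D I z) = hproj E D I (hproj A B I z).
Proof.
move=> dAB dCD dAC dED.
rewrite (@hprojE A B I z) (hproj_hmulr _ dAB dCD dAC dED).
rewrite (@hprojE E D I z) (hproj_hmull _ dED dAC dCD dAB).
rewrite /hproj tmap_compl tmap_compr.
have /= -> t := hmulA hopfH dAC dCD dED dAB t.
by have /= -> := hcomulA hopfH dAC dCD dED dAB z.
Qed.

Definition cutproj I C : {linear hobj H I -> hobj H I} := hproj C (I `\` C) I.

Lemma cutproj0 I z : cutproj I fset0 z = z.
Proof.
by rewrite /cutproj /hproj /= fsetD0 (hcomul_counitl hopfH) (hmul_unitl hopfH).
Qed.

Lemma cutprojT I z : cutproj I I z = z.
Proof.
by rewrite /cutproj /hproj /= fsetDv (hcomul_counitr hopfH) (hmul_unitr hopfH).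
Qed.

Lemma cutproj_idem I C z : C `<=` I -> cutproj I C (cutproj I C z) = cutproj I C z.
Proof. by move=> CI; rewrite /cutproj /hproj /= hcomul_hmul // decompD. Qed.

Lemma cutproj_comm I C E z : C `<=` E -> E `<=` I ->
  cutproj I C (cutproj I E z) = cutproj I E (cutproj I C z).
Proof.
move=> CE EI; have CI := fsubset_trans CE EI.
by apply: (hprojC _ (decompD CI) (decompDD CE EI) (decompD CE) (decompD EI)).
Qed.

Lemma cutproj_hmulr I C E t : C `<=` E -> E `<=` I ->
  cutproj I E (hmul H C (I `\` C) I t) =
  hmul H C (I `\` C) I (tmap idfun (hproj (E `\` C) (I `\` E) (I `\` C)) t).
Proof.
move=> CE EI; have CI := fsubset_trans CE EI.
by apply: (hproj_hmulr _ (decompD CI) (decompDD CE EI) (decompD CE) (decompD EI)).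
Qed.

Lemma cutproj_hmull I C E t : C `<=` E -> E `<=` I ->
  cutproj I C (hmul H E (I `\` E) I t) =
  hmul H E (I `\` E) I (tmap (hproj C (E `\` C) E) idfun t).
Proof.
move=> CE EI; have CI := fsubset_trans CE EI.
by apply: (hproj_hmull _ (decompD EI) (decompD CE) (decompDD CE EI) (decompD CI)).
Qed.

(** The full union is left out, since its projection is the identity. *)
Fixpoint partial_unions A (As : seq {fset U}) : seq {fset U} :=
  if As is B :: Bs then A :: [seq A `|` C | C <- partial_unions B Bs] else [::].

Lemma partial_unions_sub A As C : C \in partial_unions A As ->
  C `<=` \bigcup_(B <- A :: As) B.
Proof.
elim: As A C => //= B Bs IH A C; rewrite inE big_cons => /predU1P[->|].
  exact: fsubsetUl.
by case/mapP => E /IH EB ->; apply: fsetUS.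
Qed.

(** After the cut along [A] the remaining iterate acts on the second tensor factor; by
    [cutproj_hmulr] its cut along [C] becomes the cut of [I] along the union of [A] and [C]. *)
Lemma hmuls1_hcomuls1 A As I z : setcomp I (A :: As) ->
  hmuls1 H A As I (hcomuls1 H A As I z) =
  foldl (fun z C => cutproj I C z) z (partial_unions A As).
Proof.
elim: As A I z => [|B Bs IH] A I z cI; have UI := setcomp_bigcup cI.
  by move: UI z; rewrite big_seq1 => <- z; rewrite /= !hcast_id.
have [_ AI cB] := setcomp_cons cI.
have UJ := setcomp_bigcup cB.
set F := fun (w : hobj H I) C => cutproj I C w.
(* Additivity of the iterated projections allows the reduction to pure tensors. *)
have FD l : {morph foldl F^~ l : v w / v + w}.
  by elim: l => //= C l IHl v w; rewrite [F (v + w) C]linearD IHl.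
rewrite /= [F z A]hprojE.
elim/tens_ind: (hcomul H A (I `\` A) I z) => [a b|s s' Es Es']; last first.
  by rewrite !linearD /= Es Es' FD.
rewrite !tmapE /= IH //.
have : {in partial_unions B Bs, forall C, C `<=` I `\` A}.
  by move=> C /partial_unions_sub; rewrite UJ.
elim: (partial_unions B Bs) b => //= C l IHl b lI.
rewrite {}IHl; last by move=> E El; apply: lI; rewrite inE El orbT.
congr (foldl _ _ _).
have /fsubsetP CI := lI C (mem_head _ _).
have CD : (A `|` C) `\` A = C.
  apply/fsetP => i; rewrite in_fsetD in_fsetU; have := CI i; rewrite in_fsetD.
  by case: (i \in A); case: (i \in C) => //= /(_ isT).
have ID : (I `\` A) `\` C = I `\` (A `|` C).
  by rewrite fsetDDl.
rewrite [RHS]cutproj_hmulr ?fsubsetUl //; last first.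
  rewrite fsubUset AI; apply/fsubsetP => i /CI; by rewrite in_fsetD => /andP[].
by rewrite tmapE /= -ID CD.
Qed.

End HopfProjections.

(** * Projections in a linearized basis *)

Section LinearizedProjections.
Local Open Scope fset_scope.
Local Open Scope ring_scope.
Variables (K : fieldType) (H : hopf_data K).
Hypothesis hopfH : connected_hopf_monoid H.
Variable h : forall (U : choiceType) (I : {fset U}), set (hobj H I).
Hypothesis linH : linearized h.
Variable U : choiceType.
Implicit Types A B C D E I : {fset U}.

Definition basis0 I (z : hobj H I) := z = 0 \/ h z.

Lemma hproj_basis0 A B I z : decomp A B I -> basis0 z -> basis0 (hproj H A B I z).
Proof.
move=> dAB [->|hz]; first by left; rewrite linear0.
rewrite /hproj /=; case: (lin_comul linH dAB hz) => [->|[u [v [hu hv ->]]]].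
  by left; rewrite linear0.
by right; apply: (lin_mul linH).
Qed.

Lemma cutproj_basis0 I C z : C `<=` I -> basis0 z -> basis0 (cutproj H I C z).
Proof. by move=> CI; apply/hproj_basis0/decompD. Qed.

(* With z cut along E as u (x) v, the two projections act on different factors,
   and the common nonzero factor can be cancelled. *)
Lemma cutproj_cancel_lt I C E D z : C `<=` E -> E `<=` D -> D `<=` I -> basis0 z ->
  cutproj H I C (cutproj H I E (cutproj H I D z)) = cutproj H I E (cutproj H I D z) ->
  cutproj H I E (cutproj H I D z) <> 0 ->
  cutproj H I C (cutproj H I E z) = cutproj H I E z.
Proof.
move=> CE ED DI [->|hz]; first by rewrite !linear0.
have EI := fsubset_trans ED DI.
rewrite (cutproj_comm hopfH _ ED DI); set w := cutproj H I E z.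
have [E0|[u [v [hu hv Ez]]]] := lin_comul linH (decompD EI) hz.
  by rewrite /w /cutproj /hproj /= E0 !linear0.
have -> : w = hmul H E (I `\` E) I (u *t v) by rewrite -Ez.
rewrite (cutproj_hmulr hopfH _ ED DI) !(cutproj_hmull hopfH _ CE EI) !tmapE.
set u' := hproj H _ _ _ u; set v' := hproj H _ _ _ v => /= Euv nz.
have v'b : basis0 v'.
  by apply: hproj_basis0; [exact: decompDD|right].
case: v'b => [v0|hv'].
  by case: nz; rewrite v0 tens0r linear0.
(* [hcomul_hmul] turns the equality of products in [H[I]] into one of tensors. *)
have : u' *t v' = u *t v'.
  by rewrite -(hcomul_hmul hopfH (u' *t v') (decompD EI)) Euv
             (hcomul_hmul hopfH _ (decompD EI)).
by move/(tens_cancelr (lin_basis linH _) hv') => ->.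
Qed.

(** Mirror image: now [D] cuts the first factor and [C] the second, and the nonzero first factor is
    cancelled. *)
Lemma cutproj_cancel_gt I C E D z : D `<=` E -> E `<=` C -> C `<=` I -> basis0 z ->
  cutproj H I C (cutproj H I E (cutproj H I D z)) = cutproj H I E (cutproj H I D z) ->
  cutproj H I E (cutproj H I D z) <> 0 ->
  cutproj H I C (cutproj H I E z) = cutproj H I E z.
Proof.
move=> DE EC CI [->|hz]; first by rewrite !linear0.
have EI := fsubset_trans EC CI.
rewrite -(cutproj_comm hopfH _ DE EI); set w := cutproj H I E z.
have [E0|[u [v [hu hv Ez]]]] := lin_comul linH (decompD EI) hz.
  by rewrite /w /cutproj /hproj /= E0 !linear0.
have -> : w = hmul H E (I `\` E) I (u *t v) by rewrite -Ez.
rewrite (cutproj_hmull hopfH _ DE EI) !(cutproj_hmulr hopfH _ EC CI) !tmapE.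
set u' := hproj H _ _ _ u; set v' := hproj H _ _ _ v => /= Euv nz.
have u'b : basis0 u' by apply: hproj_basis0; [exact: decompD|right].
case: u'b => [u0|hu'].
  by case: nz; rewrite u0 tens0l linear0.
have : u' *t v' = u' *t v.
  by rewrite -(hcomul_hmul hopfH (u' *t v') (decompD EI)) Euv
             (hcomul_hmul hopfH _ (decompD EI)).
by move/(tens_cancell (lin_basis linH _) hu') => ->.
Qed.

End LinearizedProjections.

(** * Compositions into intervals of a linear order *)

Section Blocks.
Local Open Scope fset_scope.
Local Open Scope ring_scope.
Variables (U : choiceType) (b : seq U).
Hypothesis ub : uniq b.
Implicit Types (i j k : nat) (s p : seq nat).

Definition seg i j : seq U := drop i (take j b).

Fixpoint blocks i s : seq (seq U) :=
  if s is j :: s' then seg i j :: blocks j s' else [::].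

Definition segset i j : {fset U} := [fset z in seg i j].

Lemma seg_uniq i j : uniq (seg i j).
Proof. by rewrite drop_uniq // take_uniq. Qed.

Lemma size_seg i j : (j <= size b)%N -> size (seg i j) = (j - i)%N.
Proof. by move=> jb; rewrite size_drop size_takel. Qed.

Lemma seg_cat i j k : (i <= j <= k)%N -> seg i j ++ seg j k = seg i k.
Proof.
move=> /andP[ij jk]; rewrite /seg -{2}(cat_take_drop j (take k b)) take_takel //.
rewrite drop_cat; case: ltnP => // sij; rewrite drop_oversize //=.
(* In this case [seg i j] is empty, either because [i] is past the end of [b] or because [i = j]. *)
suff [bi|ji] : (size b <= i)%N \/ (j <= i)%N.
- rewrite !drop_oversize // size_take_min geq_min ?bi ?orbT //.
  by rewrite (leq_trans bi ij) orbT.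
- have -> : i = j by apply/eqP; rewrite eqn_leq ij.
  case: (leqP j (size b)) => jb; first by rewrite size_takel // subnn drop0.
  by rewrite !drop_oversize // size_take_min geq_min (ltnW jb) orbT.
- by move: sij; rewrite size_take_min geq_min => /orP[]; [right|left].
Qed.

Lemma segset_cat i j k : (i <= j <= k)%N -> segset i j `|` segset j k = segset i k.
Proof.
by move=> ijk; apply/fsetP => z; rewrite in_fsetU !inE -mem_cat seg_cat.
Qed.

Lemma path_ltn_last i s : path ltn i s -> (i <= last i s)%N.
Proof.
by elim: s i => //= j s IH i /andP[ij /IH]; apply: leq_trans; apply: ltnW.
Qed.

Lemma size_blocks i s : size (blocks i s) = size s.
Proof. by elim: s i => //= j s IH i; rewrite IH. Qed.

Lemma flatten_blocks i s : path ltn i s -> flatten (blocks i s) = seg i (last i s).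
Proof.
elim: s i => [|j s IH] i /=.
  by rewrite /seg drop_oversize // size_take_min geq_minl.
move=> /andP[ij js]; rewrite IH // seg_cat // (ltnW ij); exact: path_ltn_last.
Qed.

Lemma blocks_nonempty i s : path ltn i s -> (last i s <= size b)%N ->
  [::] \notin blocks i s.
Proof.
elim: s i => //= j s IH i /andP[ij js] sb; rewrite inE negb_or IH // andbT.
apply/eqP => /(congr1 size); rewrite size_seg ?(leq_trans (path_ltn_last js) sb) //.
by move=> /esym /eqP; rewrite subn_eq0 leqNgt ij.
Qed.

(** The cuts are the running lengths of the lists in [c], started at [i]; nonempty lists make them
    strictly increasing. *)
Lemma blocks_surj i c : (i <= size b)%N -> flatten c = drop i b -> [::] \notin c ->
  exists2 s, path ltn i s /\ last i s = size b & c = blocks i s.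
Proof.
elim: c i => [|t c IH] i ib /=.
  move=> /(congr1 size); rewrite size_drop /= => /esym /eqP; rewrite subn_eq0 => bi _.
  by exists [::] => //; split=> //; apply/eqP; rewrite eqn_leq ib.
move=> E; rewrite inE negb_or eq_sym => /andP[t0 nc].
have sE : (size t + size (flatten c))%N = (size b - i)%N by rewrite -size_drop -E size_cat.
have jb : (size t + i <= size b)%N.
  by rewrite addnC -leq_subRL // -sE leq_addr.
have [|s [ps ls] Ec] := IH (size t + i)%N jb _ nc.
  by rewrite -drop_drop -E drop_size_cat.
exists (size t + i :: s)%N; first split=> //=.
  by rewrite ps andbT -[X in (X < _)%N]add0n ltn_add2r lt0n size_eq0.
by rewrite /= Ec /seg -take_drop -E take_size_cat.
Qed.

(** As [b] has no repetition, the cardinality of the first block determines the first cut after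
    [i]. *)
Lemma blocks_inj i s s' : path ltn i s -> path ltn i s' ->
    (last i s <= size b)%N -> (last i s' <= size b)%N ->
    [seq [fset z in t] | t <- blocks i s] = [seq [fset z in t] | t <- blocks i s'] ->
  s = s'.
Proof.
elim: s s' i => [|j s IH] [|j' s'] i //= /andP[ij js] /andP[ij' js'] sb sb' [E].
have: #|` segset i j| = #|` segset i j'| by rewrite /segset E.
rewrite !card_fseq !undup_id ?seg_uniq // !size_seg; last 2 first.
- exact: leq_trans (path_ltn_last js') sb'.
- exact: leq_trans (path_ltn_last js) sb.
move=> Ej; have {Ej} Ej : j = j'.
  by rewrite -(subnKC (ltnW ij)) Ej subnKC // ltnW.
by rewrite -Ej in js' sb' *; move/(IH _ _ js js' sb sb') => ->.
Qed.

Lemma setcomp_flatten (c : seq (seq U)) : uniq (flatten c) -> [::] \notin c ->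
  setcomp [fset z in flatten c] [seq [fset z in t] | t <- c].
Proof.
elim: c => [|t c IH] /=.
  by rewrite /setcomp big_nil /= => _ _; apply/eqP/fsetP => z; rewrite !inE.
rewrite cat_uniq inE negb_or => /and3P[ut dt uc] /andP[t0 nc].
have /and3P[n0 dc /eqP Uc] := IH uc nc.
apply/and3P; split.
- rewrite inE negb_or n0 andbT; apply: contraNneq t0 => E; rewrite eq_sym.
  case: t E {ut dt} => // z t /fsetP /(_ z).
  by rewrite !inE eqxx.
- rewrite pairwise_cons dc andbT; apply/allP => _ /mapP[t' t'c ->].
  apply/fdisjointP => z; rewrite !inE => zt; apply: contra dt => zt'.
  by apply/hasP; exists z => //; apply/flattenP; exists t'.
- rewrite big_cons Uc; apply/eqP/fsetP => z; by rewrite in_fsetU !inE.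
Qed.

(** Successive intervals merge into one starting at [i]; the end cut [N] drops out with the full
    union. *)
Lemma partial_unions_blocks i p N : path ltn i (rcons p N) ->
  forall A As, [seq [fset z in t] | t <- blocks i (rcons p N)] = A :: As ->
  partial_unions A As = [seq segset i j | j <- p].
Proof.
elim: p i => [|j p IH] i /=; first by move=> _ A As [_ <-].
move=> /andP[ij jp] A As [<- EAs].
case: As EAs => [|B Bs] EAs; first by case: (p) EAs.
rewrite /= (IH _ jp _ _ EAs) -map_comp; congr (_ :: _).
apply/eq_in_map => k kp /=; rewrite segset_cat // (ltnW ij) /=.
have := order_path_min ltn_trans jp; rewrite all_rcons => /andP[_ /allP /(_ _ kp)].
exact: ltnW.
Qed.

Variable a : seq U.
Hypotheses (ua : uniq a) (ba : {subset b <= a}).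

(** The local form, on one interval of [b], of the condition alpha_A = beta. *)
Definition increasing i j := restr (segset i j) a == seg i j.

(** Restricting [a] to the longer interval first gives [seg i k], and filtering this list leaves its
    tail [seg j k]. This supplies [incl] in the chain argument. *)
Lemma increasing_suffix i j k : (i <= j < k)%N -> increasing i k -> increasing j k.
Proof.
move=> /andP[ij jk] /eqP ik; apply/eqP.
have ijk : (i <= j <= k)%N by rewrite ij ltnW.
have -> : restr (segset j k) a = restr (segset j k) (restr (segset i k) a).
  rewrite /restr -filter_predI; apply: eq_filter => z /=.
  rewrite -(segset_cat ijk) in_fsetU.
  by case: (z \in segset j k); rewrite ?orbT ?andbT.
have := seg_uniq i k; rewrite ik -(seg_cat ijk) cat_uniq => /and3P[_ /hasPn dis _].
rewrite /restr filter_cat (eq_in_filter (a2 := pred0)) ?filter_pred0 => [|z zi].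
  by apply/all_filterP/allP => z zj; rewrite !inE.
by rewrite !inE; apply: contraTF zi; exact: dis.
Qed.

Lemma path_increasing i s :
  path increasing i s =
  ([seq restr [fset z in t] a | t <- blocks i s] == blocks i s).
Proof. by elim: s i => //= j s IH i; rewrite IH eqseq_cons. Qed.

Lemma size_restr t : uniq t -> {subset t <= a} -> size (restr [fset z in t] a) = size t.
Proof.
move=> ut ta; apply: perm_size; apply: uniq_perm => //; first exact: filter_uniq.
by move=> z; rewrite mem_filter !inE; apply: andb_idr; exact: ta.
Qed.

(** Restricting [a] to a block gives a list of the same length as the block, so equal concatenations
    agree block by block. *)
Lemma restr_blocks s : path ltn 0 s -> last 0%N s = size b ->
  (flatten [seq restr [fset z in t] a | t <- blocks 0 s] == b) = path increasing 0 s.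
Proof.
move=> ps ls; rewrite path_increasing.
have fb : flatten (blocks 0 s) = b by rewrite flatten_blocks // ls /seg take_size drop0.
apply/eqP/eqP => [E|-> //].
apply: eq_from_flatten_shape (etrans E (esym fb)) _; rewrite /shape -map_comp.
apply/eq_in_map => t tc /=.
have tb z : z \in t -> z \in b by move=> zt; rewrite -fb; apply/flattenP; exists t.
apply: size_restr; last by move=> z /tb /ba.
have : uniq (flatten (blocks 0 s)) by rewrite fb.
elim: (blocks 0 s) tc => //= t' c IH; rewrite inE cat_uniq => /predU1P[->|tc] /and3P[] //.
by move=> _ _; apply: IH.
Qed.

End Blocks.

(** * Iterates in Hadamard products and the coefficients *)

Section LinearOrderIterates.
Local Open Scope fset_scope.
Local Open Scope ring_scope.
Variables (K : fieldType) (U : choiceType).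
Implicit Types (A B I J : {fset U}) (s t : seq U).

Definition lists I s : Prop := uniq s /\ s =i I.

Lemma listsP I s : reflect (lists I s) (s \in permutations (enum_fset I)).
Proof.
rewrite mem_permutations; apply: (iffP idP) => [sI|[us sI]].
  by split=> [|z]; rewrite ?(perm_uniq sI) ?fset_uniq // (perm_mem sI).
by apply: uniq_perm => //; exact: fset_uniq.
Qed.

Lemma lists_linord I (a : linord I) : lists I (val a).
Proof. by apply/listsP; case: a. Qed.

Lemma lists_restr I A s : lists I s -> A `<=` I -> lists A (restr A s).
Proof.
move=> [us sI] /fsubsetP AI; split; first exact: filter_uniq.
by move=> z; rewrite mem_filter sI; apply: andb_idr; exact: AI.
Qed.

Lemma lists_cat I A s t : A `<=` I -> lists A s -> lists (I `\` A) t ->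
  lists I (s ++ t).
Proof.
move=> /fsubsetP AI [us sA] [ut tD]; split.
  rewrite cat_uniq us ut andbT /=; apply/hasPn => z; rewrite tD in_fsetD /= sA.
  by case/andP.
move=> z; rewrite mem_cat sA tD in_fsetD.
by have := AI z; case: (z \in A); case: (z \in I) => // /(_ isT).
Qed.

Lemma restr_restr A J s : A `<=` J -> restr A (restr J s) = restr A s.
Proof.
move=> /fsubsetP AJ; rewrite /restr -filter_predI; apply: eq_filter => z /=.
by apply: andb_idr; exact: AJ.
Qed.

Lemma restr_flatten_cons I A As s : setcomp I (A :: As) ->
  flatten [seq restr B s | B <- A :: As] =
  restr A s ++ flatten [seq restr B (restr (I `\` A) s) | B <- As].
Proof.
move=> /setcomp_cons[_ _ cAs] /=; congr (_ ++ flatten _); apply/eq_in_map => B BAs.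
rewrite restr_restr // -(setcomp_bigcup cAs); apply/fsubsetP => z zB.
by apply/bigfcupP; exists B; rewrite ?BAs.
Qed.

Lemma lists_flatten I As s : lists I s -> setcomp I As ->
  lists I (flatten [seq restr B s | B <- As]).
Proof.
elim: As I s => [|A As IH] I s sI cI.
  by split=> // z; rewrite -(setcomp_bigcup cI) big_nil.
have [_ AI cAs] := setcomp_cons cI.
rewrite (restr_flatten_cons _ cI); apply: lists_cat (AI) _ _; first exact: lists_restr sI AI.
by apply: IH => //; apply: lists_restr sI _; exact: fsubsetDl.
Qed.

Lemma lext_lvec I (X : lmodType K) (F : seq U -> X) s : lists I s ->
  lext F (lvec K I s) = F s.
Proof.
move=> /listsP sI; rewrite /lext (bigD1 (SeqSub sI)) //= ffunE eqxx scale1r.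
rewrite big1 ?addr0 // => a /eqP as_; rewrite ffunE; case: eqP => [E|]; last by rewrite scale0r.
by case: as_; apply: val_inj.
Qed.

Lemma lmul_lvec A B I s t : lists A s -> lists B t ->
  lmul I (lvec K A s *t lvec K B t) = lvec K I (s ++ t).
Proof.
move=> sA tB; rewrite /lmul tlift_tens; last exact: lconcat_bilin.
by rewrite /lconcat !lext_lvec.
Qed.

Lemma linorders_iterate1 A As I s : lists I s -> setcomp I (A :: As) ->
  hmuls1 (linorders K) A As I (hcomuls1 (linorders K) A As I (lvec K I s)) =
  lvec K I (flatten [seq restr B s | B <- A :: As]).
Proof.
elim: As A I s => [|B Bs IH] A I s sI cI; have [_ AI cAs] := setcomp_cons cI.
  have := setcomp_bigcup cI; rewrite big_seq1 => EA; rewrite EA /= in cI *.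
  rewrite !hcast_id cats0; congr (lvec _ _ _); apply/esym/all_filterP/allP => z.
  by rewrite sI.2.
have sJ : lists (I `\` A) (restr (I `\` A) s).
  by apply: lists_restr sI _; exact: fsubsetDl.
have -> : hcomuls1 (linorders K) A (B :: Bs) I (lvec K I s) =
    lvec K A (restr A s) *t
      hcomuls1 (linorders K) B Bs (I `\` A) (lvec K (I `\` A) (restr (I `\` A) s)).
  by rewrite /= lext_lvec // tmapE.
rewrite [LHS]/= tmapE IH // (restr_flatten_cons _ cI).
by apply: lmul_lvec; [exact: lists_restr sI AI|exact: lists_flatten].
Qed.

Lemma linorders_iterate As I s : lists I s -> setcomp I As ->
  hmuls (linorders K) As I (hcomuls (linorders K) As I (lvec K I s)) =
  lvec K I (flatten [seq restr B s | B <- As]).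
Proof.
case: As => [|A As] sI cI; last exact: linorders_iterate1.
have := setcomp_bigcup cI; rewrite big_nil => E0; case: _ / E0 in sI *.
have -> : s = [::] by case: s sI => // z s [_ /(_ z)]; rewrite mem_head in_fset0.
by rewrite /= !hcast_id.
Qed.

End LinearOrderIterates.

Section HadamardIterates.
Local Open Scope fset_scope.
Local Open Scope ring_scope.
Variables (K : fieldType) (G H : hopf_data K) (U : choiceType).
Implicit Types (A B I : {fset U}).

(** On pure tensors the interchange in the product undoes the one in the coproduct, so the two
    factors evolve separately. *)
Lemma hadamard_iterate1 A As I a x : setcomp I (A :: As) ->
  hmuls1 (hadamard G H) A As I (hcomuls1 (hadamard G H) A As I (a *t x)) =
  hmuls1 G A As I (hcomuls1 G A As I a) *t hmuls1 H A As I (hcomuls1 H A As I x).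
Proof.
elim: As A I a x => [|B Bs IH] A I a x cI; have [_ AI cAs] := setcomp_cons cI.
  by move: a x; have := setcomp_bigcup cI; rewrite big_seq1 => <- a x; rewrite /= !hcast_id.
rewrite /= tmapE.
elim/tens_ind: (hcomul G _ _ _ a) => [a1 a2|s s' Es Es']; last first.
  by rewrite !(linearD, tensDl) /= Es Es'.
elim/tens_ind: (hcomul H _ _ _ x) => [x1 x2|s s' Es Es']; last first.
  by rewrite !(linearD, tensDr) /= Es Es'.
by rewrite !(tswapE, tmapE) /= IH // tswapE tmapE.
Qed.

Lemma hadamard_iterate As I a x : setcomp I As ->
  hmuls (hadamard G H) As I (hcomuls (hadamard G H) As I (a *t x)) =
  hmuls G As I (hcomuls G As I a) *t hmuls H As I (hcomuls H As I x).
Proof.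
case: As => [|A As] cI; last exact: hadamard_iterate1.
by move: a x; have := setcomp_bigcup cI; rewrite big_nil => <- a x; rewrite /= !hcast_id.
Qed.

End HadamardIterates.

(** * The bound on the antipode coefficients *)

Section Coefficient.
Local Open Scope fset_scope.
Local Open Scope ring_scope.
Variables (K : fieldType) (H : hopf_data K).
Hypothesis hopfH : connected_hopf_monoid H.
Variable h : forall (U : choiceType) (I : {fset U}), set (hobj H I).
Hypothesis linH : linearized h.
Variables (U : choiceType) (I : {fset U}) (x : hobj H I).
Hypothesis hx : h x.

Lemma iterate_basis0 As : setcomp I As ->
  basis0 h (hmuls H As I (hcomuls H As I x)).
Proof.
case: As => [|A As] cI.
  by right; move: x hx; have := setcomp_bigcup cI; rewrite big_nil => <- z hz;
    rewrite /= !hcast_id.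
rewrite /hmuls /hcomuls (hmuls1_hcomuls1 hopfH) //.
have : {in partial_unions A As, forall C, C `<=` I}.
  by move=> C /partial_unions_sub; rewrite (setcomp_bigcup cI).
have : basis0 h x by right.
elim: (partial_unions A As) x => //= C l IH z hz lI.
apply: IH; first by apply: cutproj_basis0 => //; apply: lI; rewrite mem_head.
by move=> E El; apply: lI; rewrite inE El orbT.
Qed.

(** A basis vector [y] is nonzero, so x_A = y forces a nonzero coproduct. *)
Lemma antipode_compsE (alpha beta : linord I) (y : hobj H I) : h y ->
  antipode_comps alpha x beta y =
  [set A | [/\ setcomp I A, restr_comp alpha A = val beta
             & hmuls H A I (hcomuls H A I x) = y]]%classic.
Proof.
move=> hy; apply/seteqP; split=> A /= [] // cA E Ey; split=> //.
by apply/eqP => E0; case: (basis_neq0 (lin_basis linH _) hy); rewrite -Ey E0 linear0.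
Qed.

Lemma antipode_coef_bound (alpha beta : linord I) (y : hobj H I) : h y ->
  antipode_coef alpha x beta y \in [:: 1; -1; 0].
Proof.
move=> hy; rewrite /antipode_coef antipode_compsE //.
have [ua aI] := lists_linord alpha; have [ub bI] := lists_linord beta.
set a := val alpha in ua aI *; set b := val beta in ub bI *.
have ba : {subset b <= a} by move=> z; rewrite bI aI.
have Ib : I = [fset z in b] by apply/fsetP => z; rewrite inE /= bI.
set S := [set A | _]%classic.
(* On the empty set only the empty composition occurs, so the coefficient is [1] or [0]; otherwise
   the interior cuts of [b] range from [1] to [n]. *)
case EN : (size b) => [|n].
  have b0 : b = [::] by exact: size0nil.
  have I0 : I = fset0 by apply/fsetP => z; rewrite -bI b0 in_fset0.
  have sub A : setcomp I A -> A = [::].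
    case: A => // A As /setcomp_cons[/eqP A0]; rewrite I0 fsubset0 => /eqP.
    by move/A0.
  case: (pselect (hmuls H [::] I (hcomuls H [::] I x) = y)) => Ey.
    have -> : S = [set [::]]%classic; last by rewrite fsbig_set1 inE eqxx.
    apply/seteqP; split=> A /=; first by move=> [/sub].
    move=> ->; split=> //.
    by rewrite /setcomp /= big_nil I0.
  rewrite fsbig1 ?inE ?eqxx ?orbT // => A /= [/sub -> _]; done.
pose P i := cutproj H I (segset b 0 i).
have sI i : segset b 0 i `<=` I.
  by apply/fsubsetP => z; rewrite inE /= /seg drop0 => /mem_take; rewrite bI.
have sS i j : (i <= j)%N -> segset b 0 i `<=` segset b 0 j.
  by move=> ij; rewrite -(@segset_cat _ b 0 i j) ?ij // fsubsetUl.
pose comp p := [seq [fset z in t] | t <- blocks b 0 (rcons p n.+1)].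
pose good p := path (increasing b a) 0 (rcons p n.+1) &&
  (foldl (fun z i => P i z) x p == y).
(* The map [comp] is injective on cut lists, so the coefficient becomes a sum over them, and
   [chain_sum_bound] applies to the projections [P]. *)
have -> : S = [set` [seq comp p | p <- cutlists n & good p]]%classic; last first.
  rewrite -fsbig_seq; last first.
    rewrite map_inj_in_uniq ?filter_uniq ?cutlists_uniq // => p q.
    rewrite !mem_filter !mem_cutlists => /andP[_ pp] /andP[_ pq] E.
    have /rcons_inj[-> //] : rcons p n.+1 = rcons q n.+1.
    by apply: (blocks_inj ub pp pq) E; rewrite last_rcons EN.
  rewrite big_map big_filter.
  under eq_bigr => p _ do rewrite size_map size_blocks size_rcons.
  apply: (@chain_sum_bound K _ 0 (basis0 h (I := I)) P) => //.
  - move=> i j z; case: (leqP i j) => [|/ltnW] ij; last apply/esym.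
      by apply: (cutproj_comm hopfH); rewrite ?sS.
    by apply: (cutproj_comm hopfH); rewrite ?sS.
  - by move=> i z; apply: (cutproj_idem hopfH).
  - by move=> i z; apply: cutproj_basis0.
  - by move=> i; rewrite /P linear0.
  - move=> z; rewrite /P (_ : segset b 0 0 = fset0) ?(cutproj0 hopfH) //.
    by apply/fsetP => w; rewrite !inE /seg take0.
  - move=> r i k z bz /orP[] /andP[/ltnW h1 /ltnW h2].
      by apply: (cutproj_cancel_lt hopfH linH); rewrite ?sS.
    by apply: (cutproj_cancel_gt hopfH linH); rewrite ?sS.
  - move=> z; rewrite /P (_ : segset b 0 n.+1 = I) ?(cutprojT hopfH) //.
    by rewrite Ib /segset /seg -EN take_size drop0.
  - by right.
  - exact: basis_neq0 (lin_basis linH _) hy.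
  - move=> i j k; exact: increasing_suffix.
have iterE p : p \in cutlists n ->
    setcomp I (comp p) ->
    hmuls H (comp p) I (hcomuls H (comp p) I x) = foldl (fun z i => P i z) x p.
  rewrite mem_cutlists => pp; have pu := @partial_unions_blocks _ b 0 p n.+1 pp.
  rewrite -/(comp p) in pu; case E : (comp p) => [|A As] cI.
    by move: E; rewrite /comp; case: (p).
  rewrite /hmuls /hcomuls (hmuls1_hcomuls1 hopfH) // (pu _ _ E) /P.
  by elim: (p) (x) => //= i q IH z; exact: IH.
apply/seteqP; split=> A /=.
  move=> [cA Ea Ey].
  (* The blocks of [A] are recovered from the restrictions of [a], which concatenate to [b]; hence
     [blocks_surj] yields the cuts. *)
  have EA : A = [seq [fset z in t] | t <- [seq restr B a | B <- A]].
    rewrite -map_comp -[LHS]map_id; apply/eq_in_map => B BA /=.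
    apply/fsetP => z; rewrite !inE mem_filter aI; apply/esym/andb_idr => zB.
    by rewrite -(setcomp_bigcup cA); apply/bigfcupP; exists B; rewrite ?BA.
  have [||s [ps ls] Es] := @blocks_surj _ b 0 [seq restr B a | B <- A] (leq0n _).
  - by rewrite drop0.
  - apply/mapP => -[B BA /esym B0]; move: (cA) => /and3P[/negP n0 _ _]; apply: n0.
    rewrite (_ : fset0 = B) //; apply/fsetP => z; rewrite in_fset0.
    have : z \in restr B a = false by rewrite B0.
    rewrite mem_filter aI => /negbT; rewrite negb_and => /orP[/negbTE -> //|].
    rewrite -(setcomp_bigcup cA) => /bigfcupP zn; apply/esym/negP => zB.
    by apply: zn; exists B; rewrite ?BA.
  case/lastP: s ps ls Es => [|p j]; first by rewrite EN.
  rewrite last_rcons EN => pp Ej; rewrite {j}Ej in pp * => Es.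
  have Ec : A = comp p by rewrite EA Es.
  have pn : p \in cutlists n by rewrite mem_cutlists.
  rewrite Ec map_f // mem_filter pn andbT /good -iterE // -?Ec //.
  rewrite Ey eqxx andbT -(restr_blocks ub ua ba) ?last_rcons ?EN // -Es.
  rewrite -map_comp; apply/eqP; rewrite -[RHS]Ea; congr flatten.
  rewrite [in RHS]EA -map_comp -map_comp //.
case/mapP => p; rewrite mem_filter => /andP[/andP[pi /eqP pE] pn] ->.
have pp := pn; rewrite mem_cutlists in pp.
have cp : setcomp I (comp p).
  have fb : flatten (blocks b 0 (rcons p n.+1)) = b.
    by rewrite flatten_blocks // last_rcons -EN /seg take_size drop0.
  have -> : I = [fset z in flatten (blocks b 0 (rcons p n.+1))].
    by apply/fsetP => z; rewrite inE /= fb bI.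
  apply: setcomp_flatten; rewrite ?fb //.
  by apply: blocks_nonempty; rewrite ?last_rcons ?EN.
split=> //; last by rewrite iterE.
apply/eqP; rewrite /restr_comp -map_comp.
by rewrite (restr_blocks ub ua ba) ?last_rcons.
Qed.

End Coefficient.

(** Terms are grouped by the value of [g]. The nonzero coefficients lie on the finite image [t],
    which gives meaning to the sum over a possibly infinite [D]. *)
Lemma fsum_regroup (K : fieldType) (V : lmodType K) (T S : choiceType) (r : seq T)
    (P : pred T) (g : T -> S) (w : T -> K) (D : set S) (vec : S -> V) (c : S -> K) :
    (forall A, A \in r -> P A -> D (g A)) ->
    (forall p, D p -> c p = \sum_(A <- r | P A && (g A == p)) w A) ->
  finite_set [set p | D p /\ c p <> 0]%classic /\
  \sum_(A <- r | P A) w A *: vec (g A) = \sum_(p \in D) c p *: vec p.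
Proof.
move=> gD cE; pose t := undup [seq g A | A <- r & P A].
have c0 p : D p -> p \notin t -> c p = 0.
  move=> Dp; rewrite cE // mem_undup => pt; rewrite big_seq_cond big1 //.
  move=> A /and3P[Ar PA /eqP Ap]; case/negP: pt; rewrite -Ap map_f //.
  by rewrite mem_filter PA.
have tD p : p \in t -> D p.
  by rewrite mem_undup => /mapP[A]; rewrite mem_filter => /andP[PA Ar] ->; exact: gD.
split.
  apply: (sub_finite_set _ (finite_seq t)) => p /= [Dp cp].
  by apply: contrapT => /negP pt; apply: cp; exact: c0.
rewrite (fsbigE t) ?undup_uniq //; last first.
  by move=> p Dp pt; rewrite c0 ?scale0r.
transitivity (\sum_(p <- t) \sum_(A <- r | P A && (g A == p)) w A *: vec (g A)); last first.
  rewrite [RHS]big_mkcond big_seq [RHS]big_seq; apply: eq_bigr => p /tD Dp.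
  rewrite ifT ?mem_set // cE // scaler_suml.
  by apply: eq_bigr => A /andP[_ /eqP ->].
rewrite (exchange_big_dep P) => [|p A _ /andP[] //] /=.
rewrite big_seq_cond [RHS]big_seq_cond; apply: eq_bigr => A /andP[Ar PA].
have gt : g A \in t by rewrite mem_undup map_f // mem_filter PA.
rewrite PA big_mkcond (bigD1_seq (g A)) ?undup_uniq //= eqxx.
by rewrite big1 ?addr0 // => p; rewrite eq_sym => /negbTE ->.
Qed.

Theorem theorem2p1 (K : fieldType) (charK : [pchar K] =i pred0)
    (H : hopf_data K) (hopfH : connected_hopf_monoid H)
    (h : forall (U : choiceType) (I : {fset U}), set (hobj H I))
    (linH : linearized h)
    (U : choiceType) (I : {fset U}) (alpha : linord I) (x : hobj H I)
    (hx : h U I x) :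
  [/\ finite_set [set p : linord I * hobj H I |
        h U I p.2 /\ antipode_coef alpha x p.1 p.2 <> 0]%classic,
      antipode (H := hadamard (linorders K) H) (I := I) (lvec K I (val alpha) *t x) =
        \sum_(p \in [set p : linord I * hobj H I | h U I p.2]%classic)
          antipode_coef alpha x p.1 p.2 *: (lvec K I (val p.1) *t p.2)
    & forall (beta : linord I) (y : hobj H I), h U I y ->
        antipode_coef alpha x beta y \in [:: 1; -1; 0]].
Proof.
pose C := [set A | setcomp I A]%classic; pose r : seq _ := fset_set C.
have memr A : (A \in r) = setcomp I A.
  rewrite in_fset_set; last exact: finite_setcomp.
  by apply/idP/idP; rewrite inE.
pose it A : hobj H I := hmuls H A I (hcomuls H A I x).
(* For a composition [A] the list [restr_comp alpha A] enumerates [I], so the default [alpha] is not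
   reached there. *)
pose g A : linord I * hobj H I := (insubd alpha (restr_comp alpha A), it A).
have gE A : setcomp I A -> val (g A).1 = restr_comp alpha A.
  move=> cA; rewrite /= val_insubd ifT //; apply/listsP.
  by apply: lists_flatten => //; exact: lists_linord.
(* Compositions whose iterate vanishes are filtered out: [0] is not a basis vector, and they
   contribute nothing to the antipode. *)
have [||fin sumE] := @fsum_regroup K (tensor (lobj K I) (hobj H I)) _ _ r
  (fun A => it A != 0) g (fun A => (-1) ^+ size A) [set p | h U I p.2]%classic
  (fun p => lvec K I (val p.1) *t p.2) (fun p => antipode_coef alpha x p.1 p.2).
- move=> A; rewrite memr => cA /eqP nz.
  by case: (iterate_basis0 hopfH linH hx cA).
- move=> [beta y] /= hy; rewrite /antipode_coef (antipode_compsE linH) //.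
  rewrite -[RHS]big_filter [RHS]fsbig_seq; last exact/filter_uniq/fset_uniq.
  apply: eq_fsbigl; apply/seteqP; split=> A /=; rewrite mem_filter memr.
    move=> [cA Eb Ey]; rewrite cA andbT /it Ey; apply/andP; split.
      exact/eqP/(basis_neq0 (lin_basis linH I) hy).
    by rewrite xpair_eqE /it Ey eqxx andbT -val_eqE (gE A cA) Eb.
  case/andP => /andP[_ /eqP[Eb Ey]] cA; split=> //.
  by rewrite -gE //= Eb.
split=> [//||beta y hy]; last exact: (antipode_coef_bound hopfH linH).
rewrite -sumE /antipode fsbig_finite; last exact: finite_setcomp.
rewrite [RHS]big_mkcond big_seq [RHS]big_seq; apply: eq_bigr => A.
rewrite memr => cA; rewrite hadamard_iterate // linorders_iterate //; last exact: lists_linord.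
rewrite gE //; case: eqP => //= it0.
by rewrite -/(it A) it0 tens0r scaler0.
Qed.
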